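(* Suppose an investor holds $1$ unit of $r$ stocks for $k$ years. For each stock $\ell\in[r]$ and each year $i\in[k]$, let $\rho_{i,\ell}$ denote the relative price of stock $\ell$ between years $i$ and $i-1$. Suppose $\rho_{i,\ell}$ has distribution $\mu_{i,\ell}$, and that each $\mu_{i,\ell}$ has at most $n$ atoms. Let $R_{\max}=\max_{\{\rho_{i,\ell}\}}\sum_{\ell=1}^r\prod_{i=1}^k\rho_{i,\ell}$ denote the maximal possible return. For any constant number of stocks $r$, there is a $\mathrm{poly}(n,k,R_{\max}/\varepsilon)$ time algorithm for $\varepsilon$-approximating the expected profit in the worst case over all futures that are consistent with the returns' marginal distributions, i.e., for $\varepsilon$-approximating $$\min_{P\in\mathcal{M}(\{\mu_{i,\ell}\}_{i\in[k],\ell\in[r]})}\ \mathbb{E}_{\{\rho_{i,\ell}\}\sim P}\Big[\sum_{\ell=1}^r\prod_{i=1}^k\rho_{i,\ell}\Big].$$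
   Context: $[m]=\{1,\dots,m\}$. If $X_{i,\ell}$ is the price of stock $\ell$ at year $i\in\{0,\dots,k\}$, the relative price (return) is $\rho_{i,\ell}=X_{i,\ell}/X_{i-1,\ell}$, a ratio of prices. $\mathcal{M}(\{\mu_{i,\ell}\})$ is the set of all joint probability distributions $P$ of $\{\rho_{i,\ell}\}_{i\in[k],\ell\in[r]}$ whose $(i,\ell)$-marginal is $\mu_{i,\ell}$ for every $i,\ell$. The maximum in $R_{\max}$ is over all choices of $\rho_{i,\ell}$ among the atoms of $\mu_{i,\ell}$. ''$\varepsilon$-approximating'' means up to additive error $\varepsilon$. The distributions are given by their atoms and weights, with polynomial bit complexity; runtimes count arithmetic operations. *)

(* Defs.v *)
From mathcomp Require Import all_boot all_order all_algebra.
From mathcomp Require Import reals.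

Set Implicit Arguments.
Unset Strict Implicit.
Unset Printing Implicit Defensive.

Import Order.TTheory GRing.Theory Num.Theory.

Local Open Scope ring_scope.

(* The model of computation is a unit-cost RAM, given as a structured
   imperative language. The memory consists of arrays of indices (in nat) and
   arrays of numbers (in rat); an array is named by a fixed number occurring in
   the program, and only positions within an array can be computed. Every
   constant, memory access, arithmetic operation, comparison, connective,
   assignment and branching costs one time unit. There is no rounding operation
   and no conversion from numbers to indices, so the usual unit-cost tricks
   based on integer division are not available. *)

Inductive nexpr : Type :=
  | NConst of nat
  | NGet of nat & nexpr
  | NAdd of nexpr & nexpr
  | NSub of nexpr & nexpr
  | NMul of nexpr & nexpr.

Inductive qexpr : Type :=
  | QConst of rat
  | QGet of nat & nexpr
  | QNat of nexpr
  | QAdd of qexpr & qexpr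
  | QSub of qexpr & qexpr
  | QMul of qexpr & qexpr
  | QDiv of qexpr & qexpr.

Inductive bexpr : Type :=
  | BLtN of nexpr & nexpr
  | BLtQ of qexpr & qexpr
  | BNot of bexpr
  | BAnd of bexpr & bexpr.

Inductive cmd : Type :=
  | Skip
  | SetN of nat & nexpr & nexpr
  | SetQ of nat & nexpr & qexpr
  | Seq of cmd & cmd
  | If of bexpr & cmd & cmd
  | While of bexpr & cmd.

Record state : Type := State {
  nmem : nat -> nat -> nat;
  qmem : nat -> nat -> rat
}.

Definition update (T : Type) (m : nat -> nat -> T) (a p : nat) (v : T) :
    nat -> nat -> T :=
  fun b q => if (b == a) && (q == p) then v else m b q.

Fixpoint neval (s : state) (e : nexpr) : nat :=
  match e with
  | NConst c => c
  | NGet a e1 => nmem s a (neval s e1)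
  | NAdd e1 e2 => (neval s e1 + neval s e2)%N
  | NSub e1 e2 => (neval s e1 - neval s e2)%N
  | NMul e1 e2 => (neval s e1 * neval s e2)%N
  end.

(* As everywhere in MathComp, x / 0 = 0. *)
Fixpoint qeval (s : state) (e : qexpr) : rat :=
  match e with
  | QConst c => c
  | QGet a e1 => qmem s a (neval s e1)
  | QNat e1 => (neval s e1)%:R
  | QAdd e1 e2 => qeval s e1 + qeval s e2
  | QSub e1 e2 => qeval s e1 - qeval s e2
  | QMul e1 e2 => qeval s e1 * qeval s e2
  | QDiv e1 e2 => qeval s e1 / qeval s e2
  end.

Fixpoint beval (s : state) (b : bexpr) : bool :=
  match b with
  | BLtN e1 e2 => (neval s e1 < neval s e2)%N
  | BLtQ e1 e2 => qeval s e1 < qeval s e2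
  | BNot b1 => ~~ beval s b1
  | BAnd b1 b2 => beval s b1 && beval s b2
  end.

Fixpoint ncost (e : nexpr) : nat :=
  match e with
  | NConst _ => 1
  | NGet _ e1 => (ncost e1).+1
  | NAdd e1 e2 | NSub e1 e2 | NMul e1 e2 => (ncost e1 + ncost e2).+1
  end.

Fixpoint qcost (e : qexpr) : nat :=
  match e with
  | QConst _ => 1
  | QGet _ e1 | QNat e1 => (ncost e1).+1
  | QAdd e1 e2 | QSub e1 e2 | QMul e1 e2 | QDiv e1 e2 =>
      (qcost e1 + qcost e2).+1
  end.

Fixpoint bcost (b : bexpr) : nat :=
  match b with
  | BLtN e1 e2 => (ncost e1 + ncost e2).+1
  | BLtQ e1 e2 => (qcost e1 + qcost e2).+1
  | BNot b1 => (bcost b1).+1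
  | BAnd b1 b2 => (bcost b1 + bcost b2).+1
  end.

(* exec c s t s' : started in s, the program c halts in s' after time t. *)
Inductive exec : cmd -> state -> nat -> state -> Prop :=
  | exec_skip s : exec Skip s 1 s
  | exec_setn a p e s :
      exec (SetN a p e) s (ncost p + ncost e).+1
        (State (update (nmem s) a (neval s p) (neval s e)) (qmem s))
  | exec_setq a p e s :
      exec (SetQ a p e) s (ncost p + qcost e).+1
        (State (nmem s) (update (qmem s) a (neval s p) (qeval s e)))
  | exec_seq c1 c2 s s1 s2 t1 t2 :
      exec c1 s t1 s1 -> exec c2 s1 t2 s2 -> exec (Seq c1 c2) s (t1 + t2) s2
  | exec_if b c1 c2 s s1 t :
      exec (if beval s b then c1 else c2) s t s1 ->
      exec (If b c1 c2) s (bcost b + t).+1 s1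
  | exec_while_done b c s :
      ~~ beval s b -> exec (While b c) s (bcost b).+1 s
  | exec_while_step b c s s1 s2 t1 t2 :
      beval s b -> exec c s t1 s1 -> exec (While b c) s1 t2 s2 ->
      exec (While b c) s (bcost b + t1 + t2).+1 s2.

Lemma exec_det c s t1 s1 t2 s2 :
  exec c s t1 s1 -> exec c s t2 s2 -> t1 = t2 /\ s1 = s2.
Proof.
move=> e1; elim: e1 t2 s2 => {c s t1 s1}.
- by move=> s t2 s2 e2; inversion e2; subst.
- by move=> a p e s t2 s2 e2; inversion e2; subst.
- by move=> a p e s t2 s2 e2; inversion e2; subst.
- move=> c1 c2 s s1 s2 t1 t2 _ IH1 _ IH2 t s' e2; inversion e2; subst.
  by have [? ?] := IH1 _ _ H1; subst; have [? ?] := IH2 _ _ H5; subst.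
- move=> b c1 c2 s s1 t _ IH t2 s2 e2; inversion e2; subst.
  by have [? ?] := IH _ _ H5; subst.
- move=> b c s nb t2 s2 e2; inversion e2; subst => //.
  by exfalso; apply: (negP nb).
- move=> b c s s1 s2 t1 t2 hb _ IH1 _ IH2 t s' e2; inversion e2; subst.
    by exfalso; match goal with nb : is_true (~~ _) |- _ => exact: (negP nb) end.
  match goal with
  | E1 : exec c s _ _, E2 : exec (While b c) _ _ s' |- _ =>
      have [? ?] := IH1 _ _ E1; subst; by have [? ?] := IH2 _ _ E2; subst
  end.
Qed.

(* A finitely supported distribution, as the list of its (atom, weight)
   pairs. *)
Definition law : Type := seq (rat * rat).

Definition atom (d : law) (j : nat) : rat := (nth (0, 0) d j).1.
Definition weight (d : law) (j : nat) : rat := (nth (0, 0) d j).2.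

Definition is_law (n : nat) (d : law) : Prop :=
  [/\ (size d <= n)%N, uniq (unzip1 d), all (fun a => 0 < a.2) d
    & \sum_(a <- d) a.2 = 1].

Definition nonneg_atoms (d : law) : bool := all (fun a => 0 <= a.1) d.

Definition bitsize (q : rat) : nat :=
  ((trunc_log 2 `|numq q|).+1 + (trunc_log 2 `|denq q|).+1)%N.

Definition law_bits_le (b : nat) (d : law) : bool :=
  all (fun a => (bitsize a.1 <= b)%N && (bitsize a.2 <= b)%N) d.

Section Market.

Variables (k r n : nat) (mu : 'I_k -> 'I_r -> law).

(* A scenario selects, for each year i and stock l, the position of the
   realized return in the list mu i l. Since atoms are pairwise distinct,
   choosing a position below size (mu i l) amounts to choosing an atom;
   positions between size (mu i l) and n have weight 0, so a joint
   distribution with the given marginals never uses them. *)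
Definition scenario : Type := {ffun 'I_k * 'I_r -> 'I_n}.

Definition admissible (w : scenario) : bool :=
  [forall i, forall l, (w (i, l) < size (mu i l))%N].

Definition payoff (w : scenario) : rat :=
  \sum_(l < r) \prod_(i < k) atom (mu i l) (w (i, l)).

(* Starting the maximum at 0 is harmless, as payoffs of nonnegative returns
   are nonnegative. *)
Definition Rmax : rat :=
  \big[Num.max/0]_(w : scenario | admissible w) payoff w.

Definition is_joint (R : realType) (P : scenario -> R) : Prop :=
  [/\ forall w, 0 <= P w, \sum_w P w = 1
    & forall i l (j : 'I_n),
        \sum_(w : scenario | w (i, l) == j) P w = ratr (weight (mu i l) j)].

Definition expected_profit (R : realType) (P : scenario -> R) : R :=
  \sum_w P w * ratr (payoff w).

Definition is_worst_case (R : realType) (v : R) : Prop :=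
  (exists2 P, is_joint P & expected_profit P = v) /\
  (forall P, is_joint P -> v <= expected_profit P).

Definition entry (i l j : nat) : rat * rat :=
  if insub i is Some i' then
    if insub l is Some l' then nth (0, 0) (mu i' l') j else (0, 0)
  else (0, 0).

Definition entry_count (i l : nat) : nat :=
  if insub i is Some i' then
    if insub l is Some l' then size (mu i' l') else 0%N
  else 0%N.

(* Input layout (all other cells are 0):
   - index array 0: k, n;
   - index array 1: the number of atoms of mu i l, at position i * r + l;
   - number array 0: eps;
   - number arrays 1 and 2: the j-th atom of mu i l and its weight, at position
     (i * r + l) * n + j.
   The constant r is not part of the input. *)
Definition input (eps : rat) : state :=
  State
    (fun a p => match a with
       | 0 => nth 0%N [:: k; n] p
       | 1 => entry_count (p %/ r) (p %% r)
       | _ => 0%N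
       end)
    (fun a p =>
       let e := entry (p %/ n %/ r) (p %/ n %% r) (p %% n) in
       match a with
       | 0 => nth 0 [:: eps] p
       | 1 => e.1
       | 2 => e.2
       | _ => 0
       end).

End Market.

Definition output (s : state) : rat := qmem s 0 0.

(* Main.v *)
Require Import Defs.
From mathcomp Require Import all_boot all_order all_algebra.
From mathcomp Require Import reals.
From mathcomp Require Import lra ring zify.
From mathcomp Require boolp classical_sets topology normedtype derive.

(** The worst case is a linear program over the joint laws of all returns, with
one variable per scenario and one equality per pair of a return and an atom.
Its dual has only k * r * n variables p(i,l,j): the dual value of p is the sum
of all weight * p, plus the minimum over scenarios w of payoff w - p(w), where
p(w) adds the p of the atoms chosen by w. The program runs subgradient ascent on
this dual and returns the average of the dual values that it meets.

The minimum over scenarios splits into one minimum per stock, of a product of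
atoms minus a sum of prices. Dividing the atoms by their maxima turns the
product into a scale times a product of numbers in [0, 1], which is tracked on
a grid of N + 1 points, rounding down after each factor; a dynamic program over
the years then finds the exact minimum for the rounded payoff
([table_le], [table_best_path]). A factor at most 1 does not amplify earlier
errors, so k roundings cost at most k / N of the scale ([chain_bounds]).

Every dual value is at most the worst case by weak duality, as rounding down
only decreases payoffs ([weak_duality], [estimate_le]). In the other direction,
let P be the uniform law on the minimizing scenarios of the T iterations. The
regret bound of subgradient ascent, taken against the dual point that charges
the total scale S wherever P falls short of a marginal, says that the expected
payoff under P plus S times the total shortfall of its marginals is at most the
average dual value plus a small error ([ascent_regret]). A law with wrong
marginals can be repaired one return at a time: moving the excess mass of one
return to where mass is missing raises the payoff of a scenario by at most the
scale of its stock ([repair], [payoff_upd]). So the repaired law has the right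
marginals and its expected payoff is at most the average dual value plus the
error ([ascent_value], [near_optimal]). The worst case is attained by
compactness ([minimizer_exists]).

With A the least integer such that S <= A * eps, grid size
N = 8 (A + 1) (k + 1) (r + 1) (n + 1), step size eps / N and T = N ^ 3
iterations, all errors add up to at most eps ([error_le]). As S <= Rmax, N is
polynomial in n, k and Rmax / eps ([grid_size_le]).

A program in which every loop makes at most B rounds runs in time polynomial in
B, with coefficient and degree read off its syntax ([time_bound_poly]); here
B = T bounds all loops ([wp_program]). *)

Import Order.TTheory GRing.Theory Num.Theory.

Local Open Scope ring_scope.

Set Implicit Arguments.
Unset Strict Implicit.
Unset Printing Implicit Defensive.

(** * Reasoning about programs *)

(** Time of c if each of its loops makes at most B rounds whenever it is
reached; both branches of a conditional are charged. *)
Fixpoint time_bound (B : nat) (c : cmd) : nat :=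
  match c with
  | Skip => 1
  | SetN _ p e => (ncost p + ncost e).+1
  | SetQ _ p e => (ncost p + qcost e).+1
  | Seq c1 c2 => (time_bound B c1 + time_bound B c2)%N
  | If b c1 c2 => (bcost b + (time_bound B c1 + time_bound B c2)).+1
  | While b c => (B * (bcost b + time_bound B c).+1 + (bcost b).+1)%N
  end.

Lemma time_bound_poly c : exists C d : nat, forall B, (time_bound B c <= C * B.+1 ^ d)%N.
Proof.
elim: c => [|a p e|a p e|c1 [C1 [d1 H1]] c2 [C2 [d2 H2]]
           |b c1 [C1 [d1 H1]] c2 [C2 [d2 H2]]|b c [C [d H]]] /=.
- by exists 1%N, 0%N.
- by exists (ncost p + ncost e).+1, 0%N => B; rewrite expn0 muln1.
- by exists (ncost p + qcost e).+1, 0%N => B; rewrite expn0 muln1.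
- exists (C1 + C2)%N, (d1 + d2)%N => B; rewrite mulnDl; apply: leq_add.
    by apply: leq_trans (H1 B) _; rewrite leq_mul2l leq_pexp2l ?orbT ?leq_addr.
  by apply: leq_trans (H2 B) _; rewrite leq_mul2l leq_pexp2l ?orbT ?leq_addl.
- exists ((bcost b).+1 + (C1 + C2))%N, (d1 + d2)%N => B.
  rewrite -addSn [X in (_ <= X)%N]mulnDl; apply: leq_add.
    by rewrite leq_pmulr // expn_gt0.
  rewrite mulnDl; apply: leq_add.
    by apply: leq_trans (H1 B) _; rewrite leq_mul2l leq_pexp2l ?orbT ?leq_addr.
  by apply: leq_trans (H2 B) _; rewrite leq_mul2l leq_pexp2l ?orbT ?leq_addl.
- exists ((bcost b).+1 + C + (bcost b).+1)%N, d.+1 => B.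
  rewrite [X in (_ <= X)%N]mulnDl; apply: leq_add; last first.
    by rewrite leq_pmulr // expn_gt0.
  rewrite expnS mulnCA; apply: leq_mul => //.
  rewrite -addSn mulnDl; apply: leq_add => //.
  by rewrite leq_pmulr // expn_gt0.
Qed.

Fixpoint nmods (c : cmd) : seq nat :=
  match c with
  | SetN a _ _ => [:: a]
  | Seq c1 c2 | If _ c1 c2 => nmods c1 ++ nmods c2
  | While _ c => nmods c
  | _ => [::]
  end.

Fixpoint qmods (c : cmd) : seq nat :=
  match c with
  | SetQ a _ _ => [:: a]
  | Seq c1 c2 | If _ c1 c2 => qmods c1 ++ qmods c2
  | While _ c => qmods c
  | _ => [::]
  end.

(** The frame condition of a run that writes only to the index arrays in na and
the number arrays in qa. *)
Definition agree (na qa : seq nat) (s s' : state) : Prop :=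
  (forall a p, a \notin na -> nmem s' a p = nmem s a p) /\
  (forall a p, a \notin qa -> qmem s' a p = qmem s a p).

Lemma agree_trans na qa s1 s2 s3 :
  agree na qa s1 s2 -> agree na qa s2 s3 -> agree na qa s1 s3.
Proof.
move=> [n1 q1] [n2 q2]; split=> a p h; first by rewrite n2 ?n1.
by rewrite q2 ?q1.
Qed.

Lemma agree_sub na qa na' qa' s s' :
  {subset na <= na'} -> {subset qa <= qa'} ->
  agree na qa s s' -> agree na' qa' s s'.
Proof.
move=> hn hq [n1 q1]; split=> a p h; [apply: n1|apply: q1].
  by apply: contra h; apply: hn.
by apply: contra h; apply: hq.
Qed.

Lemma exec_agree c s t s' : exec c s t s' -> agree (nmods c) (qmods c) s s'.
Proof.
elim=> {c s t s'} //=.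
- move=> a p e s; split=> b q //=.
  by rewrite inE /update => /negbTE ->.
- move=> a p e s; split=> b q //=.
  by rewrite inE /update => /negbTE ->.
- move=> c1 c2 s s1 s2 t1 t2 _ H1 _ H2.
  apply: (agree_trans (s2 := s1)).
    by apply: agree_sub H1 => x; rewrite mem_cat => ->.
  by apply: agree_sub H2 => x; rewrite mem_cat => ->; rewrite orbT.
- move=> b c1 c2 s s1 t _; case: (beval s b) => H.
    by apply: agree_sub H => x; rewrite mem_cat => ->.
  by apply: agree_sub H => x; rewrite mem_cat => ->; rewrite orbT.
- by move=> b c s s1 s2 t1 t2 _ _ H1 _ H2; apply: agree_trans H1 H2.
Qed.

(** Total correctness with the time bound built in, so that the rules below
establish halting, correctness and running time at once. *)
Definition wp (B : nat) (c : cmd) (Q : state -> Prop) (s : state) : Prop :=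
  exists t s', [/\ exec c s t s', (t <= time_bound B c)%N & Q s'].

Section Rules.
Variable B : nat.
Implicit Types (Q : state -> Prop) (s : state).

(** Postconditions need to mention only what a command computes: what it leaves
alone is found from its syntax. *)
Lemma wp_frame c Q s :
  wp B c (fun s' => agree (nmods c) (qmods c) s s' -> Q s') s -> wp B c Q s.
Proof.
by move=> [t [s' [e h q]]]; exists t, s'; split=> //; apply/q/exec_agree/e.
Qed.

Lemma wp_impl c Q Q' s : (forall s', Q s' -> Q' s') -> wp B c Q s -> wp B c Q' s.
Proof. by move=> h [t [s' [e l q]]]; exists t, s'; split=> //; apply: h. Qed.

Lemma wp_seq c1 c2 Q s : wp B c1 (wp B c2 Q) s -> wp B (Seq c1 c2) Q s.
Proof.
move=> [t1 [s1 [e1 l1 [t2 [s2 [e2 l2 q]]]]]].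
exists (t1 + t2)%N, s2; split=> //; [exact: exec_seq e1 e2|exact: leq_add].
Qed.

Lemma wp_set_index a p e Q s :
  Q (State (update (nmem s) a (neval s p) (neval s e)) (qmem s)) ->
  wp B (SetN a p e) Q s.
Proof. by move=> q; do 2 eexists; split; [exact: exec_setn| |exact: q]. Qed.

Lemma wp_set_number a p e Q s :
  Q (State (nmem s) (update (qmem s) a (neval s p) (qeval s e))) ->
  wp B (SetQ a p e) Q s.
Proof. by move=> q; do 2 eexists; split; [exact: exec_setq| |exact: q]. Qed.

Lemma wp_if b c1 c2 Q s :
  (beval s b -> wp B c1 Q s) -> (~~ beval s b -> wp B c2 Q s) ->
  wp B (If b c1 c2) Q s.
Proof.
move=> h1 h2.
have [t [s' [e l q]]] : wp B (if beval s b then c1 else c2) Q s.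
  by case: (boolP (beval s b)) => hb; [apply: h1|apply: h2].
exists (bcost b + t).+1, s'; split=> //=; first exact: exec_if.
rewrite ltnS leq_add2l; apply: leq_trans l _.
by case: ifP => _; rewrite ?leq_addr ?leq_addl.
Qed.

Lemma wp_skip Q s : Q s -> wp B Skip Q s.
Proof. by move=> q; exists 1%N, s; split=> //; exact: exec_skip. Qed.

Lemma wp_while (Inv : nat -> state -> Prop) m b c Q s :
  (m <= B)%N -> Inv 0%N s ->
  (forall i s', (i < m)%N -> Inv i s' -> beval s' b /\ wp B c (Inv i.+1) s') ->
  (forall s', Inv m s' -> ~~ beval s' b /\ Q s') ->
  wp B (While b c) Q s.
Proof.
move=> mB I0 Istep Iend.
suff H d i s1 : (i + d)%N = m -> Inv i s1 ->
    exists t s', [/\ exec (While b c) s1 t s',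
      (t <= d * (bcost b + time_bound B c).+1 + (bcost b).+1)%N & Q s'].
  have [t [s' [e l q]]] := H m 0%N s (add0n m) I0.
  exists t, s'; split=> //=; apply: leq_trans l _.
  by rewrite leq_add2r leq_mul2r mB orbT.
elim: d i s1 => [|d IH] i s1.
  rewrite addn0 => -> /Iend [nb q]; exists (bcost b).+1, s1; split=> //.
  exact: exec_while_done.
move=> im Ii; have im' : (i < m)%N by rewrite -im addnS ltnS leq_addr.
have [hb [t1 [s2 [e1 l1 I1]]]] := Istep i s1 im' Ii.
have [|t2 [s' [e2 l2 q]]] := IH i.+1 s2 _ I1; first by rewrite addSnnS.
exists (bcost b + t1 + t2).+1, s'; split=> //.
  exact: exec_while_step hb e1 e2.
move: l1 l2; rewrite mulSn; set x := (d * _)%N; lia.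
Qed.

End Rules.

Definition nvar (v : nat) : nexpr := NGet v (NConst 0).

(** The bound e is evaluated anew before each round; [wp_for] asks that the body
writes to no array occurring in e. *)
Definition For (v : nat) (e : nexpr) (body : cmd) : cmd :=
  Seq (SetN v (NConst 0) (NConst 0))
    (While (BLtN (nvar v) e)
      (Seq body (SetN v (NConst 0) (NAdd (nvar v) (NConst 1))))).

Fixpoint nreads (e : nexpr) : seq nat :=
  match e with
  | NConst _ => [::]
  | NGet a e1 => a :: nreads e1
  | NAdd e1 e2 | NSub e1 e2 | NMul e1 e2 => nreads e1 ++ nreads e2
  end.

Lemma neval_agree na qa s s' e :
  agree na qa s s' -> ~~ has (fun a => a \in na) (nreads e) ->
  neval s' e = neval s e.
Proof.
move=> [h _]; elim: e => //= [a e IH|e1 IH1 e2 IH2|e1 IH1 e2 IH2|e1 IH1 e2 IH2].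
- by rewrite negb_or => /andP [na' /IH ->]; rewrite h.
- by rewrite has_cat negb_or => /andP [/IH1 -> /IH2 ->].
- by rewrite has_cat negb_or => /andP [/IH1 -> /IH2 ->].
- by rewrite has_cat negb_or => /andP [/IH1 -> /IH2 ->].
Qed.

Definition set_counter (s : state) (v i : nat) : state :=
  State (update (nmem s) v 0 i) (qmem s).

(** The rule supplies the frame condition from the start of the loop, so an
invariant speaks only of the cells that the loop fills. It is required after the
counter has been advanced; as array names are literals, this differs from the
state left by the body only up to conversion for invariants that do not mention
the counter. *)
Lemma wp_for B (Inv : nat -> state -> Prop) m v e body (Q : state -> Prop) s :
  (m <= B)%N ->
  v \notin nmods body ->
  ~~ has (fun a => a \in v :: nmods body) (nreads e) ->
  neval s e = m ->
  Inv 0%N (set_counter s v 0) ->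
  (forall i s', (i < m)%N -> agree (v :: nmods body) (qmods body) s s' ->
     nmem s' v 0 = i -> Inv i s' ->
     wp B body (fun s'' => Inv i.+1 (set_counter s'' v i.+1)) s') ->
  (forall s', agree (v :: nmods body) (qmods body) s s' -> Inv m s' -> Q s') ->
  wp B (For v e body) Q s.
Proof.
move=> mB vb er em I0 Istep Iend.
apply: wp_seq; apply: wp_set_index => /=.
pose J i s' := [/\ agree (v :: nmods body) (qmods body) s s',
                   nmem s' v 0 = i & Inv i s'].
have evm s' : agree (v :: nmods body) (qmods body) s s' -> neval s' e = m.
  by move=> ag; rewrite -em; apply: neval_agree ag er.
have agv s' i : agree (v :: nmods body) (qmods body) s' (set_counter s' v i).
  split=> a p //=; rewrite inE negb_or /update => /andP [h _].
  by rewrite (negbTE h).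
apply: (@wp_while B J m) => //.
- by split; [exact: (agv s 0%N)|rewrite /= /update eqxx|exact: I0].
- move=> i s' im [ag vi Ii]; split.
    by rewrite /= vi (evm _ ag).
  apply: wp_seq; apply: wp_frame; have := Istep i s' im ag vi Ii.
  apply: wp_impl => s2 I2 ag2; apply: wp_set_index => /=.
  have v2 : nmem s2 v 0 = i by rewrite ag2.1.
  rewrite v2 addn1; split; [|by rewrite /= /update eqxx|exact: I2].
  apply: agree_trans ag _; apply: agree_trans (agv _ _).
  by apply: agree_sub ag2 => // x hx; rewrite inE hx orbT.
- move=> s' [ag vm Im]; split; last exact: Iend.
  by rewrite /= vm (evm _ ag) ltnn.
Qed.

(** * The rounded dynamic program *)

(** The integer part of x, for x in [0, N], in the form in which the program
finds it: there is no rounding operation, so candidates are counted. *)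
Definition grid_floor (N : nat) (x : rat) : nat :=
  (\sum_(q < N) (q.+1%:R <= x)%R)%N.

Lemma grid_floor_le N x : (grid_floor N x <= N)%N.
Proof.
rewrite /grid_floor -[X in (_ <= X)%N]card_ord -sum1_card.
by apply: leq_sum => q _; case: (_ <= _).
Qed.

(** By induction on N: raising the upper limit of the count changes it only
once x has reached the new limit, and then all earlier candidates count. *)
Lemma grid_floorP N x : 0 <= x -> x <= N%:R ->
  (grid_floor N x)%:R <= x < (grid_floor N x).+1%:R.
Proof.
move=> x0 xN.
suff [h1 h2] : (grid_floor N x)%:R <= x /\
    (grid_floor N x = N \/ x < (grid_floor N x).+1%:R).
  rewrite h1 /=; case: h2 => [->|//].
  by apply: le_lt_trans xN _; rewrite ltr_nat.
elim: N {xN} => [|N [IH1 IH2]].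
  by rewrite /grid_floor big_ord0; split=> //; left.
have e : grid_floor N.+1 x = (grid_floor N x + (N.+1%:R <= x)%R)%N.
  by rewrite /grid_floor big_ord_recr.
have := grid_floor_le N x; rewrite e => fN.
have [Nx|xN] := leP N.+1%:R x.
  suff -> : grid_floor N x = N by rewrite addn1; split=> //; left.
  case: IH2 => // h; have := le_lt_trans Nx h; rewrite ltr_nat; lia.
rewrite addn0; split=> //; right; case: IH2 => // fe.
by rewrite fe.
Qed.

(** The first minimizer, which is the one that a scan with a strict test
keeps. *)
Fixpoint argmin (f : nat -> rat) (n : nat) : nat :=
  if n is m.+1 then if f m < f (argmin f m) then m else argmin f m else 0%N.

Lemma argminP f n : (0 < n)%N ->
  (argmin f n < n)%N /\ forall j, (j < n)%N -> f (argmin f n) <= f j.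
Proof.
elim: n => //= -[|n] IH _ /=.
  by rewrite if_same; split=> // -[].
have [//|h1 h2] := IH; rewrite /= in h1 h2.
case: ltP => h.
  split=> // j; rewrite ltnS leq_eqVlt => /orP [/eqP -> //|/h2 h'].
  exact: ltW (lt_le_trans h h').
split; first exact: leqW.
by move=> j; rewrite ltnS leq_eqVlt => /orP [/eqP -> //|/h2].
Qed.

(** For one stock, b holds its atoms divided by the yearly maxima, M is the
product of these maxima and p the dual prices. Grid point s stands for the
partial product s / N. *)
Section Oracle.

Variables (n N : nat) (b : nat -> nat -> rat) (M : rat) (p : nat -> nat -> rat).

Definition next_cell (i s j : nat) : nat := grid_floor N (s%:R * b i j).

(** Least rounded payoff minus prices over the choices for the years below i,
when the later years have brought the product to grid point s. Years are
processed downwards so that the table can be filled upwards. *)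
Fixpoint table (i s : nat) : rat :=
  if i is i'.+1 then
    let f j := table i' (next_cell i' s j) - p i' j in f (argmin f n)
  else M / N%:R * s%:R.

Definition best_atom (i s : nat) : nat :=
  argmin (fun j => table i (next_cell i s j) - p i j) n.

Fixpoint best_path (i s : nat) : nat -> nat :=
  if i is i'.+1 then
    fun y => if y == i' then best_atom i' s else best_path i' (next_cell i' s (best_atom i' s)) y
  else fun=> 0%N.

Fixpoint chain (w : nat -> nat) (i s : nat) : nat :=
  if i is i'.+1 then chain w i' (next_cell i' s (w i')) else s.

Lemma tableS i s : table i.+1 s = table i (next_cell i s (best_atom i s)) - p i (best_atom i s).
Proof. by []. Qed.

Lemma chain_ext w w' i s : (forall y, (y < i)%N -> w y = w' y) ->
  chain w i s = chain w' i s.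
Proof.
elim: i s => //= i IH s h; rewrite h // IH // => y yi; apply: h; exact: leqW.
Qed.

Lemma table_le w i s : (forall y, (y < i)%N -> (w y < n)%N) ->
  table i s <= M / N%:R * (chain w i s)%:R - \sum_(y < i) p y (w y).
Proof.
elim: i s => [|i IH] s h; first by rewrite big_ord0 subr0.
have wi := h i (leqnn _).
rewrite big_ord_recr /= opprD addrA lerBrDr.
apply: le_trans (IH _ _) => [|y yi]; last by apply: h; exact: leqW.
rewrite -lerBrDr; have [|_] := @argminP (fun j => table i (next_cell i s j) - p i j) n.
  exact: leq_trans wi.
by apply.
Qed.

Lemma table_best_path i s :
  table i s = M / N%:R * (chain (best_path i s) i s)%:R - \sum_(y < i) p y (best_path i s y).
Proof.
elim: i s => [|i IH] s; first by rewrite big_ord0 subr0.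
rewrite tableS IH big_ord_recr /= eqxx opprD addrA.
congr (_ - _); set s1 := next_cell i s _; congr (_ * _%:R - _).
  by apply: chain_ext => y yi; rewrite ltn_eqF.
by apply: eq_bigr => y _; rewrite ltn_eqF.
Qed.

Lemma best_path_lt i s y : (0 < n)%N -> (best_path i s y < n)%N.
Proof.
move=> n0; elim: i s => [|i IH] s //=; case: eqP => // _.
by have [] := @argminP (fun j => table i (next_cell i s j) - p i j) n n0.
Qed.

Hypothesis b01 : forall i j, 0 <= b i j <= 1.

(** Each rounding loses at most 1, and the remaining factors, being at most 1,
do not enlarge this loss. *)
Lemma chain_bounds (w : nat -> nat) i s : (s <= N)%N ->
  s%:R * (\prod_(y < i) b y (w y)) - i%:R <= (chain w i s)%:R
    <= s%:R * \prod_(y < i) b y (w y).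
Proof.
elim: i s => [|i IH] s sN /=; first by rewrite big_ord0 mulr1 subr0 lexx.
have /andP [b0 b1] := b01 i (w i).
have x0 : 0 <= s%:R * b i (w i) by rewrite mulr_ge0.
have xN : s%:R * b i (w i) <= N%:R.
  apply: le_trans (ler_piMr _ b1) _ => //; by rewrite ler_nat.
have /andP [] := grid_floorP x0 xN; rewrite -/(next_cell i s (w i)).
set s1 := next_cell i s (w i) => h1 h2.
have /andP [h3 h4] := IH s1 (grid_floor_le _ _).
rewrite big_ord_recr /=; set P := \prod_(_ < _) _ in h3 h4 *.
have P0 : 0 <= P by apply: prodr_ge0 => y _; case/andP: (b01 y (w y)).
have P1 : P <= 1.
  have : P <= \prod_(y < i) 1 by apply: ler_prod.
  by rewrite big1_eq.
rewrite -natr1 in h2 *; apply/andP; split; last first.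
  apply: le_trans h4 _; rewrite [P * _]mulrC mulrA; exact: ler_wpM2r.
apply: le_trans h3; rewrite [P * _]mulrC mulrA.
have : (s%:R * b i (w i) - 1) * P <= s1%:R * P.
  by apply: ler_wpM2r => //; rewrite lerBlDr ltW.
rewrite mulrBl mul1r; rewrite -natr1; lra.
Qed.

End Oracle.

(** * The program for one stock *)

Definition qvar (v : nat) : qexpr := QGet v (NConst 0).
Definition set_nvar (v : nat) (e : nexpr) : cmd := SetN v (NConst 0) e.
Definition set_qvar (v : nat) (e : qexpr) : cmd := SetQ v (NConst 0) e.

(* Memory layout. A scalar is position 0 of its own array.
   Index arrays: 0 input sizes; 2 the integer A; 3 grid size N; 4 number T of
   iterations; 5 iteration; 6 stock; 7 year; 8 grid point; 9 atom; 10 and 11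
   candidate and result of the floor; 12 and 16 best atom and the grid point
   that it leads to; 13 grid point of the traced path; 14 and 15 best atom and
   next grid point for each year and grid point.
   Number arrays: 0 tolerance, at the end the result; 1 and 2 input atoms and
   weights; 3, 4, 5 prices, scaled atoms and weights of the current stock;
   6 its scale; 7 total scale; 8 table; 9 best value; 10 sum of dual values;
   11 maximal atom; 12 and 13 argument of the floor and candidate value. *)
Definition years_expr : nexpr := NGet 0 (NConst 0).
Definition atoms_expr : nexpr := NGet 0 (NConst 1).
Definition grid_expr : nexpr := nvar 3.
Definition succ_expr (e : nexpr) : nexpr := NAdd e (NConst 1).
Definition pos_expr (m i j : nexpr) : nexpr := NAdd (NMul i m) j.
Definition cell_expr (i : nexpr) : nexpr := pos_expr atoms_expr i (nvar 9).
Definition row_expr (i s : nexpr) : nexpr := pos_expr (succ_expr grid_expr) i s.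

Definition floor_cmd : cmd :=
  Seq (set_nvar 11 (NConst 0))
    (For 10 grid_expr
      (If (BLtQ (qvar 12) (QNat (succ_expr (nvar 10))))
        Skip (set_nvar 11 (succ_expr (nvar 11))))).

Definition candidate_cmd : cmd :=
  Seq (set_qvar 12 (QMul (QNat (nvar 8)) (QGet 4 (cell_expr (nvar 7)))))
  (Seq floor_cmd
  (Seq (set_qvar 13 (QSub (QGet 8 (row_expr (nvar 7) (nvar 11)))
                       (QGet 3 (cell_expr (nvar 7)))))
    (If (BAnd (BLtN (NConst 0) (nvar 9))
              (BNot (BLtQ (qvar 13) (qvar 9))))
      Skip
      (Seq (set_qvar 9 (qvar 13))
      (Seq (set_nvar 12 (nvar 9)) (set_nvar 16 (nvar 11))))))).

Definition best_cmd : cmd := For 9 atoms_expr candidate_cmd.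

Definition row_cmd : cmd :=
  For 8 (succ_expr grid_expr)
    (Seq best_cmd
    (Seq (SetQ 8 (row_expr (succ_expr (nvar 7)) (nvar 8)) (qvar 9))
    (Seq (SetN 14 (row_expr (nvar 7) (nvar 8)) (nvar 12))
         (SetN 15 (row_expr (nvar 7) (nvar 8)) (nvar 16))))).

Definition table_cmd : cmd :=
  Seq (For 8 (succ_expr grid_expr)
        (SetQ 8 (nvar 8)
          (QMul (QDiv (qvar 6) (QNat grid_expr)) (QNat (nvar 8)))))
      (For 7 years_expr row_cmd).

Definition step_expr : qexpr := QDiv (qvar 0) (QNat grid_expr).

(** Adds the dual value of the current prices, and the part of the subgradient
step that comes from the weights; the prices must be read for the former
before they change. *)
Definition gain_cmd : cmd :=
  Seq (set_qvar 10 (QAdd (qvar 10) (QGet 8 (row_expr years_expr grid_expr))))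
    (For 7 years_expr
      (For 9 atoms_expr
        (Seq (set_qvar 10 (QAdd (qvar 10)
               (QMul (QGet 5 (cell_expr (nvar 7))) (QGet 3 (cell_expr (nvar 7))))))
             (SetQ 3 (cell_expr (nvar 7)) (QAdd (QGet 3 (cell_expr (nvar 7)))
               (QMul step_expr (QGet 5 (cell_expr (nvar 7))))))))).

Definition back_expr : nexpr := NSub years_expr (succ_expr (nvar 7)).

(** Follows the minimizing path from the last year to the first, and lowers the
price of each atom on it by one step. *)
Definition trace_cmd : cmd :=
  Seq (set_nvar 13 grid_expr)
    (For 7 years_expr
      (Seq (set_nvar 9 (NGet 14 (row_expr back_expr (nvar 13))))
      (Seq (SetQ 3 (cell_expr back_expr) (QSub (QGet 3 (cell_expr back_expr)) step_expr))
           (set_nvar 13 (NGet 15 (row_expr back_expr (nvar 13))))))).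

Definition iteration_cmd : cmd := Seq table_cmd (Seq gain_cmd trace_cmd).

(** Row-major positions do not collide, by uniqueness of Euclidean division. *)
Lemma pos_eq m i j i' j' : (j < m)%N -> (j' < m)%N ->
  (i * m + j == i' * m + j')%N = (i == i') && (j == j').
Proof.
move=> jm jm'; apply/eqP/andP => [e|[/eqP -> /eqP -> //]].
have m0 : (0 < m)%N by exact: leq_ltn_trans jm.
have := congr1 (modn^~ m) e; rewrite /= !modnMDl !modn_small // => ->.
have := congr1 (divn^~ m) e; rewrite /= !divnMDl // !divn_small // !addn0 => ->.
by [].
Qed.

Lemma update_pos (T : Type) (f : nat -> nat -> T) a m i j i' j' v :
  (j < m)%N -> (j' < m)%N ->
  update f a (i * m + j) v a (i' * m + j') =
  if (i' == i) && (j' == j) then v else f a (i' * m + j')%N.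
Proof. by move=> jm jm'; rewrite /update eqxx pos_eq. Qed.

Lemma update_ne (T : Type) (f : nat -> nat -> T) a p v b q : b != a ->
  update f a p v b q = f b q.
Proof. by rewrite /update => /negbTE ->. Qed.

Lemma updateE (T : Type) (f : nat -> nat -> T) a p v b q :
  update f a p v b q =
  if b == a then if q == p then v else f b q else f b q.
Proof. by rewrite /update; case: (b == a). Qed.

Section Iteration.

Variables (B k n N : nat) (b mu : nat -> nat -> rat) (M eps : rat).
Hypothesis kB : (k <= B)%N.
Hypothesis nB : (n <= B)%N.
Hypothesis NB : (N < B)%N.
Hypothesis n0 : (0 < k)%N -> (0 < n)%N.

Implicit Types (Q : state -> Prop) (s : state) (p : nat -> nat -> rat).

Definition stock_loaded s : Prop :=
  [/\ nmem s 0 0 = k /\ nmem s 0 1 = n, nmem s 3 0 = N,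
      forall i j, (i < k)%N -> (j < n)%N ->
        qmem s 4 (i * n + j) = b i j /\ qmem s 5 (i * n + j) = mu i j
    & qmem s 6 0 = M /\ qmem s 0 0 = eps].

Lemma stock_loaded_agree na qa s s' :
  agree na qa s s' -> ~~ has (fun a => a \in na) [:: 0%N; 3%N] ->
  ~~ has (fun a => a \in qa) [:: 0%N; 4%N; 5%N; 6%N] -> stock_loaded s -> stock_loaded s'.
Proof.
move=> [hn hq]; rewrite /= !orbF !negb_or => /andP [n0' n3].
move=> /and4P [q0 q4 q5 q6] [[e1 e2] e3 e4 [e5 e6]].
split; [by rewrite !hn|by rewrite hn| |by rewrite !hq].
by move=> i j ik jn; rewrite !hq //; exact: e4.
Qed.

Lemma wp_floor Q s : nmem s 3 0 = N ->
  (forall s', agree (nmods floor_cmd) (qmods floor_cmd) s s' ->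
     nmem s' 11 0 = grid_floor N (qmem s 12 0) -> Q s') ->
  wp B floor_cmd Q s.
Proof.
move=> sN sQ; apply: wp_frame; apply: wp_seq; apply: wp_set_index.
set s1 := State _ _.
pose Inv i (s' : state) := nmem s' 11 0 =
  (\sum_(q < i) (q.+1%:R <= qmem s 12 0)%R)%N.
apply: (@wp_for B Inv N) => //.
- exact: ltnW.
- by rewrite /Inv big_ord0.
- move=> i s' iN ag vi Ii.
  have e12 : qmem s' 12 0 = qmem s 12 0 by rewrite ag.2.
  apply: wp_if; rewrite /= vi addn1 e12 => h; [apply: wp_skip|apply: wp_set_index];
    rewrite /Inv /= /update /= big_ord_recr /= Ii.
    by rewrite leNgt h addn0.
  by rewrite leNgt h.
- by move=> s' ag Is ag'; apply: sQ.
Qed.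

(** The scan does not set up its best value beforehand: the first candidate is
always taken, so nothing is claimed about the result while j = 0. *)
Lemma wp_best Q s i x (w q : nat -> rat) : stock_loaded s -> (i < k)%N ->
  nmem s 7 0 = i -> nmem s 8 0 = x ->
  (forall x', (x' <= N)%N -> qmem s 8 (i * N.+1 + x')%N = w x') ->
  (forall j, (j < n)%N -> qmem s 3 (i * n + j)%N = q j) ->
  let f j := w (next_cell N b i x j) - q j in
  (forall s', agree (nmods best_cmd) (qmods best_cmd) s s' ->
     nmem s' 12 0 = argmin f n -> nmem s' 16 0 = next_cell N b i x (argmin f n) ->
     qmem s' 9 0 = f (argmin f n) -> Q s') ->
  wp B best_cmd Q s.
Proof.
move=> es ik si sx sw sq f sQ; apply: wp_frame.
pose Inv j s' := (0 < j)%N ->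
  [/\ nmem s' 12 0 = argmin f j, nmem s' 16 0 = next_cell N b i x (argmin f j)
    & qmem s' 9 0 = f (argmin f j)].
have sn : neval s atoms_expr = n by case: es => -[].
apply: (@wp_for B Inv n) => //.
- move=> j s1 jn ag1 vj Ij.
  have e1 : stock_loaded s1 by apply: stock_loaded_agree ag1 _ _ es.
  have [[_ N1] G1 C1 _] := e1.
  have i1 : nmem s1 7 0 = i by rewrite ag1.1.
  have x1 : nmem s1 8 0 = x by rewrite ag1.1.
  apply: wp_seq; apply: wp_set_number; apply: wp_seq; apply: wp_floor => //= s2 ag2.
  rewrite {1}/update /= i1 x1 vj N1 (C1 _ _ ik jn).1 -/(next_cell N b i x j) => f2.
  have i2 : nmem s2 7 0 = i by rewrite ag2.1.
  have j2 : nmem s2 9 0 = j by rewrite ag2.1.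
  have n2 : nmem s2 0 1 = n by rewrite ag2.1.
  have N2 : nmem s2 3 0 = N by rewrite ag2.1.
  have w2 : qmem s2 8 (i * N.+1 + next_cell N b i x j)%N = w (next_cell N b i x j).
    by rewrite ag2.2 //= /update /= ag1.2 // sw // grid_floor_le.
  have q2 : qmem s2 3 (i * n + j)%N = q j by rewrite ag2.2 //= /update /= ag1.2 ?sq.
  have b2 : qmem s2 9 0 = qmem s1 9 0 by rewrite ag2.2.
  have m2 : nmem s2 12 0 = nmem s1 12 0 by rewrite ag2.1.
  have o2 : nmem s2 16 0 = nmem s1 16 0 by rewrite ag2.1.
  apply: wp_seq; apply: wp_set_number => /=.
  rewrite i2 j2 n2 N2 f2 addn1 w2 q2 -/(f j).
  apply: wp_if => /=; rewrite /update /= j2 b2.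
    move=> /andP [j0 nlt]; apply: wp_skip => _ /=.
    have [h1 h2 h3] := Ij j0; rewrite /Inv /update /=.
    by move: nlt; rewrite h3 => /negbTE ->; rewrite m2 o2 b2.
  move=> hlt; apply: wp_seq; apply: wp_set_number; apply: wp_seq; apply: wp_set_index.
  apply: wp_set_index => _ /=; rewrite /update /= j2 f2.
  suff -> : (if f j < f (argmin f j) then j else argmin f j) = j by [].
  move: hlt; rewrite negb_and negbK => /orP [|].
    by rewrite -eqn0Ngt => /eqP ->; rewrite if_same.
  move=> h; case: (posnP j) => [->|j0]; first by rewrite if_same.
  by have [_ _ h3] := Ij j0; rewrite h3 in h; rewrite h.
- move=> s' _ Is ag; have [] := Is (n0 (leq_ltn_trans (leq0n _) ik)).
  exact: sQ.
Qed.

Definition dual_stored p s : Prop := forall i j, (i < k)%N -> (j < n)%N ->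
  qmem s 3 (i * n + j) = p i j.

Lemma wp_table Q s p : stock_loaded s -> dual_stored p s ->
  (forall s', agree (nmods table_cmd) (qmods table_cmd) s s' ->
     (forall i x, (i <= k)%N -> (x <= N)%N ->
        qmem s' 8 (i * N.+1 + x) = table n N b M p i x) ->
     (forall i x, (i < k)%N -> (x <= N)%N ->
        nmem s' 14 (i * N.+1 + x) = best_atom n N b M p i x /\
        nmem s' 15 (i * N.+1 + x) = next_cell N b i x (best_atom n N b M p i x)) ->
     Q s') ->
  wp B table_cmd Q s.
Proof.
move=> es ps sQ; apply: wp_frame; apply: wp_seq.
have [[k0 n0'] N0 C0 [M0 E0]] := es.
pose Inv1 i (s' : state) := forall x, (x < i)%N ->
  qmem s' 8 (0 * N.+1 + x)%N = M / N%:R * x%:R.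
apply: (@wp_for B Inv1 N.+1) => //.
- by rewrite /= N0 addn1.
- move=> x s1 xN ag1 vx Ix; apply: wp_set_number => y; rewrite ltnS => yx /=.
  have n1 : nmem s1 3 0 = N by rewrite ag1.1.
  have m1 : qmem s1 6 0 = M by rewrite ag1.2.
  rewrite vx n1 m1 (@update_pos _ _ _ N.+1 0 x 0 y) //; last first.
    exact: leq_ltn_trans yx xN.
  rewrite eqxx; case: (y =P x) => [-> //|/eqP ne].
  by apply: Ix; rewrite ltn_neqAle ne.
move=> s1 ag1 I1.
pose Inv2 i x (s' : state) :=
  (forall i' x', (x' <= N)%N -> (i' <= i)%N || (i' == i.+1) && (x' < x)%N ->
     qmem s' 8 (i' * N.+1 + x') = table n N b M p i' x') /\
  (forall i' x', (x' <= N)%N -> (i' < i)%N || (i' == i) && (x' < x)%N ->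
     nmem s' 14 (i' * N.+1 + x') = best_atom n N b M p i' x' /\
     nmem s' 15 (i' * N.+1 + x') = next_cell N b i' x' (best_atom n N b M p i' x')).
have es1 : stock_loaded s1 by apply: stock_loaded_agree ag1 _ _ es.
have ps1 : dual_stored p s1 by move=> i j ik jn; rewrite ag1.2 // ps.
apply: (@wp_for B (fun i => Inv2 i 0%N) k) => //.
- by rewrite /= ag1.1.
- split=> [i' x' x'N|i' x' x'N]; rewrite ltn0 andbF orbF // leqn0 => /eqP ->.
  exact: I1.
- move=> i s2 ik ag2 vi I2.
  have es2 : stock_loaded s2 by apply: stock_loaded_agree ag2 _ _ es1.
  have [_ N2 _ _] := es2.
  apply: (@wp_for B (Inv2 i) N.+1) => //.
  + by rewrite /= N2 addn1.
  + move=> x s3 xN ag3 vx I3.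
    have es3 : stock_loaded s3 by apply: stock_loaded_agree ag3 _ _ es2.
    have i3 : nmem s3 7 0 = i by rewrite ag3.1.
    have [_ N3 _ _] := es3.
    apply: wp_seq.
    apply: (@wp_best _ _ i x (table n N b M p i) (p i)) => //.
    * by move=> x' x'N; apply: I3.1; rewrite ?leqnn.
    * by move=> j jn; rewrite ag3.2 // ag2.2 // ps1.
    move=> s4 ag4 j4 o4 b4.
    have i4 : nmem s4 7 0 = i by rewrite ag4.1.
    have x4 : nmem s4 8 0 = x by rewrite ag4.1.
    have N4 : nmem s4 3 0 = N by rewrite ag4.1.
    apply: wp_seq; apply: wp_set_number; apply: wp_seq; apply: wp_set_index.
    apply: wp_set_index => /=; rewrite !update_ne // i4 x4 N4 !addn1 j4 o4 b4.
    split=> i' x' x'N c.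
      rewrite /= update_pos //=; case: andP => [[/eqP -> /eqP -> //]|ne].
      rewrite ag4.2 //; apply: I3.1 => //.
      case/orP: c => [-> //|/andP [/eqP ei]]; rewrite ltnS leq_eqVlt.
      case/orP => [/eqP ex|->]; last by rewrite ei eqxx orbT.
      by case: ne; rewrite ei ex.
    have d : ~ (i' = i /\ x' = x) -> (i' < i)%N || (i' == i) && (x' < x)%N.
      move=> ne; case/orP: c => [-> //|/andP [/eqP ei]]; rewrite ltnS leq_eqVlt.
      case/orP => [/eqP ex|->]; last by rewrite ei eqxx orbT.
      by case: ne.
    split; rewrite /= (@update_ne _ _ 8) //.
      rewrite (@update_ne _ _ 15) // update_pos //.
      case: andP => [[/eqP -> /eqP -> //]|ne].
      rewrite ag4.1 //; apply: (I3.2 _ _ _ _).1 => //; apply: d.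
      by move=> [? ?]; apply: ne; rewrite !(introT eqP).
    rewrite update_pos //.
    case: andP => [[/eqP -> /eqP -> //]|ne].
    rewrite update_ne // ag4.1 //; apply: (I3.2 _ _ _ _).2 => //; apply: d.
    by move=> [? ?]; apply: ne; rewrite !(introT eqP).
  + move=> s3 _ [I3 I3']; split=> i' x' x'N c.
      apply: I3 => //; case/orP: c => [|]; last by rewrite ltn0 andbF.
      by rewrite leq_eqVlt ltnS => /orP [->|->] //; rewrite ltnS x'N orbT.
    apply: I3' => //; case/orP: c => [|]; last by rewrite ltn0 andbF.
    by rewrite ltnS leq_eqVlt => /orP [->|->] //; rewrite ltnS x'N orbT.
- move=> s2 _ [I2 I2'] ag; apply: sQ.
  + exact: ag.
  + by move=> i x ik xN; apply: I2; rewrite ?ik.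
  + by move=> i x ik xN; apply: I2'; rewrite ?ik.
Qed.


Definition step_size : rat := eps / N%:R.

(** The contribution of one stock to the dual function at p. *)
Definition dual_value p : rat :=
  table n N b M p k N + \sum_(i < k) \sum_(j < n) mu i j * p i j.

Lemma wp_gain Q s p : stock_loaded s -> dual_stored p s ->
  qmem s 8 (k * N.+1 + N) = table n N b M p k N ->
  (forall s', agree (nmods gain_cmd) (qmods gain_cmd) s s' ->
     dual_stored (fun i j => p i j + step_size * mu i j) s' ->
     qmem s' 10 0 = qmem s 10 0 + dual_value p -> Q s') ->
  wp B gain_cmd Q s.
Proof.
move=> es ps ws sQ; apply: wp_frame.
have [[k0 n0'] N0 C0 [M0 E0]] := es.
apply: wp_seq; apply: wp_set_number => /=; rewrite k0 N0 addn1 ws.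
set a0 := _ + table _ _ _ _ _ _ _; set s1 := State _ _.
have ag1 : agree [::] [:: 10%N] s s1.
  by split=> // a q; rewrite inE => ne; rewrite /= update_ne.
have es1 : stock_loaded s1 by apply: stock_loaded_agree ag1 _ _ es.
have ps1 : dual_stored p s1 by move=> i j ik jn; rewrite ag1.2 // ps.
have acc1 : qmem s1 10 0 = a0 by rewrite /= /update !eqxx.
pose Inv i j s' :=
  dual_stored (fun i' j' => if (i' < i)%N || (i' == i) && (j' < j)%N
                      then p i' j' + step_size * mu i' j' else p i' j') s' /\
  qmem s' 10 0 = a0 + \sum_(i' < i) \sum_(j' < n) mu i' j' * p i' j'
                    + \sum_(j' < j) mu i j' * p i j'.
apply: (@wp_for B (fun i => Inv i 0%N) k) => //.
- split; last by rewrite !big_ord0 !addr0; exact: acc1.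
  by move=> i j ik jn; rewrite !ltn0 andbF; exact: ps1.
- move=> i s2 ik ag2 vi I2.
  have es2 : stock_loaded s2 by apply: stock_loaded_agree ag2 _ _ es1.
  have [[k2 n2] _ _ _] := es2.
  apply: (@wp_for B (Inv i) n) => //.
  + move=> j s3 jn ag3 vj [I3 A3].
    have es3 : stock_loaded s3 by apply: stock_loaded_agree ag3 _ _ es2.
    have i3 : nmem s3 7 0 = i by rewrite ag3.1.
    have [[_ n3] N3 C3 [M3 E3]] := es3.
    apply: wp_seq; apply: wp_set_number; apply: wp_set_number; rewrite /= !update_ne //.
    rewrite i3 vj n3 N3 E3 (C3 _ _ ik jn).2 (I3 _ _ ik jn).
    rewrite ltnn eqxx ltnn /= -/step_size; split.
      move=> i' j' i'k j'n; rewrite /= update_pos //.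
      rewrite update_ne // (I3 _ _ i'k j'n) ltnS [(j' <= j)%N]leq_eqVlt.
      case: (i' =P i) => [->|]; case: (j' =P j) => [->|] //=.
      by rewrite ltnn.
    rewrite /= update_ne // /update !eqxx /= A3.
    by rewrite [in RHS]big_ord_recr /= !addrA.
  + move=> s3 _ [I3 A3]; split.
      move=> i' j' i'k j'n; rewrite /= (I3 _ _ i'k j'n) j'n andbT andbF orbF.
      by rewrite ltnS [(i' <= i)%N]leq_eqVlt orbC.
    by rewrite /= A3 big_ord0 addr0 big_ord_recr /= addrA.
- move=> s2 _ [I2 A2] ag; apply: sQ => //.
    by move=> i j ik jn; rewrite (I2 _ _ ik jn) ik.
  by rewrite A2 big_ord0 addr0 /a0 /dual_value addrA.
Qed.

(** The tables belong to the prices p from before the step, while the array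
already holds p2. *)
Lemma wp_trace Q s p p2 : stock_loaded s -> dual_stored p2 s ->
  (forall i x, (i < k)%N -> (x <= N)%N ->
     nmem s 14 (i * N.+1 + x) = best_atom n N b M p i x /\
     nmem s 15 (i * N.+1 + x) = next_cell N b i x (best_atom n N b M p i x)) ->
  (forall s', agree (nmods trace_cmd) (qmods trace_cmd) s s' ->
     dual_stored (fun i j => p2 i j - step_size * (best_path n N b M p k N i == j)%:R) s' -> Q s') ->
  wp B trace_cmd Q s.
Proof.
move=> es ps js sQ; apply: wp_frame.
have [_ N0 _ _] := es.
apply: wp_seq; apply: wp_set_index => /=; rewrite N0.
set s1 := State _ _.
have ag1 : agree [:: 13%N] [::] s s1.
  by split=> // a q; rewrite inE => ne; rewrite /= update_ne.
have es1 : stock_loaded s1 by apply: stock_loaded_agree ag1 _ _ es.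
pose T := best_path n N b M p k N.
pose Inv d s' :=
  [/\ (nmem s' 13 0 <= N)%N,
      forall y, (y < k - d)%N -> T y = best_path n N b M p (k - d) (nmem s' 13 0) y
    & dual_stored (fun i j => if (i < k - d)%N then p2 i j
                        else p2 i j - step_size * (T i == j)%:R) s'].
apply: (@wp_for B Inv k) => //.
- by case: es1 => -[].
- by split=> [|y|i j ik jn]; rewrite /= ?subn0 ?ik //; exact: ps.
- move=> d s2 dk ag2 vd [cN trd I2].
  have es2 : stock_loaded s2 by apply: stock_loaded_agree ag2 _ _ es1.
  have [[k2 n2] N2 _ [_ E2]] := es2.
  set y := (k - d.+1)%N; have yk : (y < k)%N by rewrite /y; lia.
  have kd : (k - d)%N = y.+1 by rewrite /y; lia.
  set c := nmem s2 13 0 in cN trd.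
  have [j2 f2] : nmem s2 14 (y * N.+1 + c) = best_atom n N b M p y c /\
      nmem s2 15 (y * N.+1 + c) = next_cell N b y c (best_atom n N b M p y c).
    by rewrite !ag2.1 // /s1 /= !update_ne //; exact: js.
  have nn : (0 < n)%N by apply: n0; exact: leq_ltn_trans yk.
  have jn : (best_atom n N b M p y c < n)%N.
    by have [] := @argminP (fun j => table n N b M p y (next_cell N b y c j) - p y j) n nn.
  have Ty : T y = best_atom n N b M p y c by rewrite trd kd //= eqxx.
  apply: wp_seq; apply: wp_set_index; apply: wp_seq; apply: wp_set_number.
  apply: wp_set_index; rewrite /= !updateE /= k2 vd addn1 -/y N2 addn1 -/c j2 f2.
  rewrite n2 E2 -/step_size (I2 _ _ yk jn) kd ltnSn.
  split; rewrite /= ?updateE /=.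
  + exact: grid_floor_le.
  + by move=> z zy; rewrite trd kd 1?leqW //= ltn_eqF.
  + move=> i j ik jn'; rewrite /= update_pos // -/y.
    rewrite (I2 _ _ ik jn') kd ltnS [(i <= y)%N]leq_eqVlt.
    case: (i =P y) => [->|//] /=.
    rewrite ltnn Ty eq_sym; case: (_ =P _) => [->|_]; first by rewrite mulr1.
    by rewrite mulr0 subr0.
- move=> s2 _ [_ _ I2] ag; apply: sQ => //.
  by move=> i j ik jn; rewrite (I2 _ _ ik jn) subnn ltn0.
Qed.

Definition dual_update p (i j : nat) : rat :=
  p i j + step_size * mu i j - step_size * (best_path n N b M p k N i == j)%:R.

Lemma wp_iteration Q s p : stock_loaded s -> dual_stored p s ->
  (forall s', agree (nmods iteration_cmd) (qmods iteration_cmd) s s' -> dual_stored (dual_update p) s' ->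
     qmem s' 10 0 = qmem s 10 0 + dual_value p -> Q s') ->
  wp B iteration_cmd Q s.
Proof.
move=> es ps sQ; apply: wp_frame; apply: wp_seq.
apply: (wp_table es ps) => s1 ag1 w1 j1.
have es1 : stock_loaded s1 by apply: stock_loaded_agree ag1 _ _ es.
have ps1 : dual_stored p s1 by move=> i j ik jn; rewrite ag1.2 // ps.
apply: wp_seq; apply: (wp_gain es1 ps1); first exact: w1.
move=> s2 ag2 ps2 acc2.
have es2 : stock_loaded s2 by apply: stock_loaded_agree ag2 _ _ es1.
apply: (wp_trace (p := p) es2 ps2).
  by move=> i x ik xN; rewrite !ag2.1 //; exact: j1.
move=> s3 ag3 ps3 ag; apply: sQ => //.
by rewrite ag3.2 // acc2 ag1.2.
Qed.

End Iteration.

(** * The complete program *)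

Definition input_expr (r : nat) : nexpr :=
  pos_expr atoms_expr (pos_expr (NConst r) (nvar 7) (nvar 6)) (nvar 9).

Definition max_cmd (r : nat) : cmd :=
  Seq (set_qvar 11 (QConst 0))
    (For 9 atoms_expr
      (If (BLtQ (qvar 11) (QGet 1 (input_expr r)))
        (set_qvar 11 (QGet 1 (input_expr r))) Skip)).

(** Local two-dimensional copies spare the iterations the three-dimensional
layout of the input. Prices restart at 0 for each stock. *)
Definition copy_cmd (r : nat) : cmd :=
  For 9 atoms_expr
    (Seq (SetQ 4 (cell_expr (nvar 7)) (QDiv (QGet 1 (input_expr r)) (qvar 11)))
    (Seq (SetQ 5 (cell_expr (nvar 7)) (QGet 2 (input_expr r)))
         (SetQ 3 (cell_expr (nvar 7)) (QConst 0)))).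

Definition load_cmd (r : nat) : cmd :=
  Seq (set_qvar 6 (QConst 1))
    (For 7 years_expr
      (Seq (max_cmd r)
      (Seq (set_qvar 6 (QMul (qvar 6) (qvar 11)))
           (copy_cmd r)))).

(** A separate pass over the stocks, as the grid size depends on the total
scale. *)
Definition total_cmd (r : nat) : cmd :=
  For 6 (NConst r) (Seq (load_cmd r) (set_qvar 7 (QAdd (qvar 7) (qvar 6)))).

Definition ceil_cmd : cmd :=
  While (BLtQ (QMul (QNat (nvar 2)) (qvar 0)) (qvar 7))
    (set_nvar 2 (succ_expr (nvar 2))).

Definition parameters_cmd (r : nat) : cmd :=
  Seq (set_nvar 3 (NMul (NMul (NMul (NMul (NConst 8) (succ_expr (nvar 2)))
        (succ_expr years_expr)) (NConst r.+1)) (succ_expr atoms_expr)))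
      (set_nvar 4 (NMul (NMul grid_expr grid_expr) grid_expr)).

Definition solve_cmd (r : nat) : cmd :=
  For 6 (NConst r) (Seq (load_cmd r) (For 5 (nvar 4) iteration_cmd)).

Definition program (r : nat) : cmd :=
  Seq (total_cmd r)
  (Seq ceil_cmd
  (Seq (parameters_cmd r)
  (Seq (solve_cmd r)
       (set_qvar 0 (QDiv (qvar 10) (QNat (nvar 4))))))).

Fixpoint maxupto (f : nat -> rat) (n : nat) : rat :=
  if n is m.+1 then Num.max (maxupto f m) (f m) else 0.

Lemma maxupto_ge f n j : (j < n)%N -> f j <= maxupto f n.
Proof.
elim: n => //= n IH; rewrite ltnS leq_eqVlt => /orP [/eqP ->|/IH h].
  by rewrite le_max lexx orbT.
by rewrite le_max h.
Qed.

Lemma maxupto_ge0 f n : 0 <= maxupto f n.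
Proof. by elim: n => //= n IH; rewrite le_max IH. Qed.

Lemma maxupto_attained f n : (0 < n)%N -> (forall j, 0 <= f j) ->
  exists2 j, (j < n)%N & f j = maxupto f n.
Proof.
move=> + f0; elim: n => // -[_ _|n IH _].
  by exists 0%N => //=; rewrite max_r.
have [//|j jn fj] := IH; rewrite [maxupto f _.+2]/=; case: leP => h.
  by exists n.+1.
by exists j => //; exact: leqW.
Qed.

Section Program.

Variables (B k r n : nat) (a m : nat -> nat -> nat -> rat) (eps : rat).
Hypothesis kB : (k <= B)%N.
Hypothesis rB : (r <= B)%N.
Hypothesis nB : (n <= B)%N.
Implicit Types (Q : state -> Prop) (s : state) (p : nat -> nat -> rat).

Definition maxatom (l i : nat) : rat := maxupto (a l i) n.
(** If the largest atom is 0, all shares are 0 / 0 = 0, so that an atom is always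
the maximum times its share. *)
Definition share (l i j : nat) : rat := a l i j / maxatom l i.
Definition scale (l : nat) : rat := \prod_(i < k) maxatom l i.

Definition market_loaded s : Prop :=
  [/\ nmem s 0 0 = k, nmem s 0 1 = n, qmem s 0 0 = eps
    & forall i l j, (i < k)%N -> (l < r)%N -> (j < n)%N ->
        qmem s 1 ((i * r + l) * n + j) = a l i j /\
        qmem s 2 ((i * r + l) * n + j) = m l i j].

Lemma market_loaded_agree na qa s s' :
  agree na qa s s' -> ~~ has (fun a => a \in na) [:: 0%N] ->
  ~~ has (fun a => a \in qa) [:: 0%N; 1%N; 2%N] -> market_loaded s -> market_loaded s'.
Proof.
move=> [hn hq]; rewrite /= !orbF !negb_or => n0' /and3P [q0 q1 q2].
move=> [e1 e2 e3 e4]; split; rewrite ?hn ?hq // => i l j ik lr jn.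
by rewrite !hq //; exact: e4.
Qed.

Lemma wp_max Q s l i : market_loaded s -> (l < r)%N -> (i < k)%N ->
  nmem s 6 0 = l -> nmem s 7 0 = i ->
  (forall s', agree (nmods (max_cmd r)) (qmods (max_cmd r)) s s' ->
     qmem s' 11 0 = maxatom l i -> Q s') ->
  wp B (max_cmd r) Q s.
Proof.
move=> ss lr ik sl si sQ; apply: wp_frame; apply: wp_seq; apply: wp_set_number.
set s1 := State _ _.
have ag1 : agree [::] [:: 11%N] s s1.
  by split=> // b q; rewrite inE => ne; rewrite /= update_ne.
have ss1 : market_loaded s1 by apply: market_loaded_agree ag1 _ _ ss.
pose Inv j s' := qmem s' 11 0 = maxupto (a l i) j.
apply: (@wp_for B Inv n) => //.
- by case: ss1.
- move=> j s2 jn ag2 vj I2.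
  have ss2 : market_loaded s2 by apply: market_loaded_agree ag2 _ _ ss1.
  have [k2 n2 E2 S2] := ss2.
  have i2 : nmem s2 7 0 = i by rewrite ag2.1.
  have l2 : nmem s2 6 0 = l by rewrite ag2.1.
  have a2 := (S2 i l j ik lr jn).1.
  apply: wp_if; rewrite /= i2 l2 n2 vj a2 I2 => h;
    [apply: wp_set_number|apply: wp_skip]; rewrite /Inv /= /update /=.
    by rewrite i2 l2 n2 vj a2 /Order.max h.
  by rewrite I2 /Order.max (negbTE h).
- by move=> s2 _ I2 ag; apply: sQ.
Qed.

Lemma wp_load Q s l : market_loaded s -> (l < r)%N -> nmem s 6 0 = l ->
  (forall s', agree (nmods (load_cmd r)) (qmods (load_cmd r)) s s' ->
     dual_stored k n (fun _ _ => 0) s' ->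
     (forall i j, (i < k)%N -> (j < n)%N ->
       qmem s' 4 (i * n + j) = share l i j /\ qmem s' 5 (i * n + j) = m l i j) ->
     qmem s' 6 0 = scale l -> Q s') ->
  wp B (load_cmd r) Q s.
Proof.
move=> ss lr sl sQ; apply: wp_frame; apply: wp_seq; apply: wp_set_number.
set s1 := State _ _.
have ag1 : agree [::] [:: 6%N] s s1.
  by split=> // b q; rewrite inE => ne; rewrite /= update_ne.
have ss1 : market_loaded s1 by apply: market_loaded_agree ag1 _ _ ss.
pose D i j s' := forall i' j', (i' < k)%N -> (j' < n)%N ->
  (i' < i)%N || (i' == i) && (j' < j)%N ->
  [/\ qmem s' 3 (i' * n + j') = 0, qmem s' 4 (i' * n + j') = share l i' j'
    & qmem s' 5 (i' * n + j') = m l i' j'].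
pose Inv i s' := D i 0%N s' /\ qmem s' 6 0 = \prod_(i' < i) maxatom l i'.
apply: (@wp_for B Inv k) => //.
- by case: ss1.
- by split=> [i j _ _|]; rewrite ?ltn0 ?andbF // big_ord0.
- move=> i s2 ik ag2 vi [D2 M2].
  have ss2 : market_loaded s2 by apply: market_loaded_agree ag2 _ _ ss1.
  have l2 : nmem s2 6 0 = l by rewrite ag2.1.
  apply: wp_seq; apply: (wp_max ss2 lr ik l2 vi) => s3 ag3 mx3.
  have ss3 : market_loaded s3 by apply: market_loaded_agree ag3 _ _ ss2.
  apply: wp_seq; apply: wp_set_number; rewrite /= mx3.
  set s4 := State _ _.
  have ag4 : agree [::] [:: 6%N] s3 s4.
    by split=> // b q; rewrite inE => ne; rewrite /= update_ne.
  have ss4 : market_loaded s4 by apply: market_loaded_agree ag4 _ _ ss3.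
  have M4 : qmem s4 6 0 = \prod_(i' < i.+1) maxatom l i'.
    by rewrite /= /update /= ag3.2 // M2 big_ord_recr.
  have D4 : D i 0%N s4.
    by move=> i' j' i'k j'n c; rewrite !ag4.2 // !ag3.2 //; apply: D2.
  apply: (@wp_for B (D i) n) => //.
  + by case: ss4.
  + move=> j s5 jn ag5 vj D5.
    have ss5 : market_loaded s5 by apply: market_loaded_agree ag5 _ _ ss4.
    have [k5 n5 E5 S5] := ss5.
    have i5 : nmem s5 7 0 = i by rewrite ag5.1 // ag4.1 // ag3.1.
    have l5 : nmem s5 6 0 = l by rewrite ag5.1 // ag4.1 // ag3.1.
    have [a5 w5] := S5 i l j ik lr jn.
    have mx5 : qmem s5 11 0 = maxatom l i by rewrite ag5.2 // ag4.2.
    apply: wp_seq; apply: wp_set_number; apply: wp_seq; apply: wp_set_number.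
    apply: wp_set_number; rewrite /= !updateE /= i5 l5 n5 vj a5 w5 mx5.
    move=> i' j' i'k j'n c /=; rewrite !updateE /= !pos_eq //.
    case: andP => [[/eqP -> /eqP -> //]|ne]; apply: D5 => //.
    case/orP: c => [-> //|/andP [/eqP ei]]; rewrite ltnS leq_eqVlt.
    case/orP => [/eqP ex|->]; last by rewrite ei eqxx orbT.
    by case: ne; rewrite ei ex.
  + move=> s5 ag5 D5; split; last by rewrite /= ag5.2.
    move=> i' j' i'k j'n; rewrite ltn0 andbF orbF ltnS leq_eqVlt => c.
    by apply: D5 => //; rewrite j'n andbT orbC.
- move=> s2 _ [D2 M2] ag; apply: sQ => //.
    by move=> i j ik jn; have [] := D2 i j ik jn; rewrite ?ik.
  by move=> i j ik jn; have [] := D2 i j ik jn; rewrite ?ik.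
Qed.


Definition total : rat := \sum_(l < r) scale l.

Lemma wp_total Q s : market_loaded s -> qmem s 7 0 = 0 ->
  (forall s', agree (nmods (total_cmd r)) (qmods (total_cmd r)) s s' ->
     qmem s' 7 0 = total -> Q s') ->
  wp B (total_cmd r) Q s.
Proof.
move=> ss s7 sQ; apply: wp_frame.
pose Inv l s' := qmem s' 7 0 = \sum_(l' < l) scale l'.
apply: (@wp_for B Inv r) => //; first by rewrite /Inv big_ord0.
- move=> l s1 lr ag1 vl I1.
  have ss1 : market_loaded s1 by apply: market_loaded_agree ag1 _ _ ss.
  apply: wp_seq; apply: (wp_load ss1 lr vl) => s2 ag2 _ _ M2.
  apply: wp_set_number; rewrite /Inv big_ord_recr /= /update /= M2.
  by rewrite ag2.2 // I1.
- by move=> s1 _ I1 ag; apply: sQ.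
Qed.

Variables (A N T : nat).
Hypothesis Asmall : forall i : nat, (i < A)%N -> i%:R * eps < total.
Hypothesis Alarge : total <= A%:R * eps.
Hypothesis NE : N = (8 * A.+1 * k.+1 * r.+1 * n.+1)%N.
Hypothesis TE : T = (N * N * N)%N.
Hypothesis AB : (A <= B)%N.
Hypothesis NB : (N < B)%N.
Hypothesis TB : (T <= B)%N.
Hypothesis n0 : (0 < r)%N -> (0 < k)%N -> (0 < n)%N.

(** There is no rounding operation: A is found by counting up, which is
affordable as A is at most about Rmax / eps. *)
Lemma wp_ceil Q s : market_loaded s -> qmem s 7 0 = total -> nmem s 2 0 = 0%N ->
  (forall s', agree (nmods ceil_cmd) (qmods ceil_cmd) s s' ->
     nmem s' 2 0 = A -> Q s') ->
  wp B ceil_cmd Q s.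
Proof.
move=> [_ _ E0 _] s7 s2 sQ; apply: wp_frame.
pose Inv i s' := [/\ nmem s' 2 0 = i, qmem s' 0 0 = eps & qmem s' 7 0 = total].
apply: (@wp_while B Inv A) => //.
- move=> i s1 iA [v1 e1 t1]; split; first by rewrite /= v1 e1 t1 Asmall.
  by apply: wp_set_index; split; rewrite //= v1 addn1.
- move=> s1 [v1 e1 t1]; split; first by rewrite /= v1 e1 t1 -leNgt.
  by move=> ag; apply: sQ.
Qed.

(** The stocks share step size and number of iterations, so ascending for one
stock after the other is ascending for all of them at the same time. *)
Definition dual (l t : nat) : nat -> nat -> rat :=
  iter t (dual_update k n N (share l) (m l) (scale l) eps) (fun _ _ => 0).

Definition gain (l t : nat) : rat :=
  dual_value k n N (share l) (m l) (scale l) (dual l t).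

Lemma wp_solve Q s : market_loaded s -> nmem s 3 0 = N -> nmem s 4 0 = T ->
  qmem s 10 0 = 0 ->
  (forall s', agree (nmods (solve_cmd r)) (qmods (solve_cmd r)) s s' ->
     qmem s' 10 0 = \sum_(l < r) \sum_(t < T) gain l t -> Q s') ->
  wp B (solve_cmd r) Q s.
Proof.
move=> ss s3 s4 s10 sQ; apply: wp_frame.
pose Inv l s' := qmem s' 10 0 = \sum_(l' < l) \sum_(t < T) gain l' t.
apply: (@wp_for B Inv r) => //; first by rewrite /Inv big_ord0.
- move=> l s1 lr ag1 vl I1.
  have ss1 : market_loaded s1 by apply: market_loaded_agree ag1 _ _ ss.
  apply: wp_seq; apply: (wp_load ss1 lr vl) => s2 ag2 p2 d2 M2.
  have [k2 n2 e2 _] : market_loaded s2 by apply: market_loaded_agree ag2 _ _ ss1.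
  have env2 : stock_loaded k n N (share l) (m l) (scale l) eps s2.
    by split=> //; rewrite ag2.1 // ag1.1.
  have T2 : nmem s2 4 0 = T by rewrite ag2.1 // ag1.1.
  have acc2 : qmem s2 10 0 = \sum_(l' < l) \sum_(t < T) gain l' t.
    by rewrite ag2.2 // I1.
  pose Inv' t s' := dual_stored k n (dual l t) s' /\
    qmem s' 10 0 = qmem s2 10 0 + \sum_(t' < t) gain l t'.
  apply: (@wp_for B Inv' T) => //.
  + by split; [exact: p2|rewrite /= big_ord0 addr0].
  + move=> t s5 tT ag5 vt [p5 acc5].
    have env5 : stock_loaded k n N (share l) (m l) (scale l) eps s5.
      by apply: stock_loaded_agree ag5 _ _ env2.
    apply: (wp_iteration kB nB NB _ env5 p5).
      by apply: n0; exact: leq_ltn_trans lr.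
    move=> s6 ag6 p6 acc6; split; first exact: p6.
    by rewrite /= acc6 acc5 big_ord_recr /= -addrA.
  + by move=> s5 ag5 [_ acc5]; rewrite /Inv /= acc5 acc2 big_ord_recr.
- by move=> s1 _ I1 ag; apply: sQ.
Qed.

Lemma wp_program s : market_loaded s -> nmem s 2 0 = 0%N -> qmem s 7 0 = 0 ->
  qmem s 10 0 = 0 ->
  wp B (program r) (fun s' => output s' =
    (\sum_(l < r) \sum_(t < T) gain l t) / T%:R) s.
Proof.
move=> ss s2 s7 s10.
apply: wp_seq; apply: (wp_total ss s7) => s1 ag1 tot1.
have ss1 : market_loaded s1 by apply: market_loaded_agree ag1 _ _ ss.
apply: wp_seq; apply: (wp_ceil ss1 tot1); first by rewrite ag1.1.
move=> s3 ag3 A3; have ss3 : market_loaded s3 by apply: market_loaded_agree ag3 _ _ ss1.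
apply: wp_seq; apply: wp_frame; apply: wp_seq; apply: wp_set_index; apply: wp_set_index.
have [k3 n3 e3 _] := ss3.
rewrite /= !updateE /= k3 n3 A3 !addn1 -NE -TE.
set s4 := State _ _ => ag4.
have ss4 : market_loaded s4 by apply: market_loaded_agree ag4 _ _ ss3.
apply: wp_seq; apply: (wp_solve ss4) => //.
  by rewrite ag4.2 // ag3.2 // ag1.2.
move=> s5 ag5 acc5; apply: wp_set_number; rewrite /output /= /update /= acc5.
by rewrite ag5.1.
Qed.

End Program.

(** * Couplings *)

Section Coupling.

Variables (F : realFieldType) (I : finType) (n : nat).
Local Notation scen := {ffun I -> 'I_n}.
Implicit Types (P : scen -> F) (w : scen) (x y : I) (f c : scen -> F).

Definition expect P f : F := \sum_w P w * f w.
Definition marginal P x (j : 'I_n) : F := \sum_(w : scen | w x == j) P w.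
Definition upd w x (j : 'I_n) : scen := [ffun y => if y == x then j else w y].
Definition is_prob (T : finType) (P : T -> F) : Prop :=
  (forall z, 0 <= P z) /\ \sum_z P z = 1.
(** The total variation distance, for probability vectors. *)
Definition deficit (mu m : 'I_n -> F) : F := \sum_j Num.max 0 (mu j - m j).

Lemma expect_coord P x (g : 'I_n -> F) :
  expect P (fun w => g (w x)) = \sum_j marginal P x j * g j.
Proof.
rewrite /expect (partition_big (fun w => w x) xpredT) //=.
by apply: eq_bigr => j _; rewrite big_distrl /=; apply: eq_bigr => w /eqP ->.
Qed.

Lemma marginal_expect P x j : marginal P x j = expect P (fun w => (w x == j)%:R).
Proof.
rewrite /marginal /expect big_mkcond; apply: eq_bigr => w _.
by case: eqP; rewrite ?mulr1 ?mulr0.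
Qed.

Lemma marginal_prob P x : is_prob P -> is_prob (marginal P x).
Proof.
move=> [P0 P1]; split=> [j|]; first by apply: sumr_ge0.
by rewrite -P1 (partition_big (fun w => w x) xpredT).
Qed.

(** The law of a scenario drawn from P whose coordinate x is then redrawn by the
kernel K. *)
Definition move_mass P x (K : 'I_n -> 'I_n -> F) : scen -> F :=
  fun w' => \sum_w P w * \sum_j K (w x) j * (w' == upd w x j)%:R.

Lemma expect_move P x K f :
  expect (move_mass P x K) f =
  expect P (fun w => \sum_j K (w x) j * f (upd w x j)).
Proof.
rewrite /expect /move_mass.
under eq_bigr do rewrite mulr_suml.
rewrite exchange_big /=; apply: eq_bigr => w _.
under eq_bigr do rewrite -mulrA mulr_suml.
rewrite -mulr_sumr exchange_big /=; congr (_ * _); apply: eq_bigr => j _.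
rewrite (bigD1 (upd w x j)) //= eqxx mulr1 big1 ?addr0 // => w' /negbTE ->.
by rewrite mulr0 mul0r.
Qed.

Lemma deficit_sym mu m : is_prob mu -> is_prob m ->
  \sum_j Num.max 0 (m j - mu j) = deficit mu m.
Proof.
move=> [_ mu1] [_ m1]; apply/eqP; rewrite -subr_eq0 -sumrB.
rewrite (eq_bigr (fun j => m j - mu j)) ?sumrB ?mu1 ?m1 ?subrr //.
by move=> j _; case: (leP 0 (m j - mu j)); case: (leP 0 (mu j - m j)); lra.
Qed.

(** Redraw coordinate x: an atom with too much mass is left with the probability
that corrects its mass, and then a new atom is drawn in proportion to the
missing masses. The coordinate changes with probability the deficit, and each
change costs at most L. *)
Lemma repair_one P x (mu : 'I_n -> F) c (L : F) :
  is_prob P -> is_prob mu ->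
  (forall w j, c (upd w x j) <= c w + L) ->
  exists P', [/\ is_prob P', forall j, marginal P' x j = mu j,
    forall y j, y != x -> marginal P' y j = marginal P y j
    & expect P' c <= expect P c + L * deficit mu (marginal P x)].
Proof.
move=> pP pmu hc; set m := marginal P x; set D := deficit mu m.
have [pm0 pm1] : is_prob m := marginal_prob x pP.
have [mu0 mu1] := pmu; have [P0 P1] := pP.
have D0 : 0 <= D by apply: sumr_ge0 => j _; rewrite le_max lexx.
have [De|Dn] := eqVneq D 0.
  exists P; rewrite De mulr0 addr0; split=> // j.
  have e1 : Num.max 0 (mu j - m j) = 0.
    by apply: (psumr_eq0P _ De) => // i _; rewrite le_max lexx.
  have De' := etrans (deficit_sym pmu (conj pm0 pm1)) De.
  have e2 : Num.max 0 (m j - mu j) = 0.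
    by apply: (psumr_eq0P _ De') => // i _; rewrite le_max lexx.
  move: e1 e2; rewrite -/m.
  by case: (leP 0 (m j - mu j)); case: (leP 0 (mu j - m j)); lra.
have Dp : 0 < D by rewrite lt_neqAle eq_sym Dn.
pose th j := Num.max 0 (m j - mu j) / m j.
pose q j := Num.max 0 (mu j - m j) / D.
have th0 j : 0 <= th j by rewrite divr_ge0 // le_max lexx.
have th1 j : th j <= 1.
  have [me|mn] := eqVneq (m j) 0; first by rewrite /th me invr0 mulr0 ler01.
  have mp : 0 < m j by rewrite lt_neqAle eq_sym mn pm0.
  by rewrite /th ler_pdivrMr // mul1r ge_max pm0 /= gerBl.
have mth j : m j * th j = Num.max 0 (m j - mu j).
  have [me|mn] := eqVneq (m j) 0; last by rewrite /th mulrC divfK.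
  rewrite me mul0r; apply/esym/max_l; rewrite sub0r oppr_le0; exact: mu0.
have q0 j : 0 <= q j by rewrite divr_ge0 // le_max lexx.
have q1 : \sum_j q j = 1 by rewrite -mulr_suml divff.
pose K i j := (i == j)%:R * (1 - th i) + th i * q j.
have K0 i j : 0 <= K i j.
  apply: addr_ge0; apply: mulr_ge0; [exact: ler0n|by rewrite subr_ge0|exact: th0|exact: q0].
have Ksum i (g : 'I_n -> F) :
    \sum_j K i j * g j = (1 - th i) * g i + th i * \sum_j q j * g j.
  under eq_bigr do rewrite mulrDl; rewrite big_split /=; congr (_ + _).
    rewrite (bigD1 i) //= eqxx mul1r big1 ?addr0 // => j.
    by rewrite eq_sym => /negbTE ->; rewrite !mul0r.
  by rewrite mulr_sumr; apply: eq_bigr => j _; rewrite mulrA.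
have K1 i : \sum_j K i j = 1.
  have := Ksum i (fun=> 1); under eq_bigr do rewrite mulr1.
  move=> ->; under eq_bigr do rewrite mulr1.
  by rewrite q1 !mulr1 subrK.
have P'1 : expect (move_mass P x K) (fun=> 1) = 1.
  rewrite expect_move -[RHS]P1; apply: eq_bigr => w _.
  by under eq_bigr do rewrite mulr1; rewrite K1 mulr1.
exists (move_mass P x K); split.
- split=> [w|]; last by rewrite -P'1; apply: eq_bigr => w _; rewrite mulr1.
  by apply: sumr_ge0 => v _; rewrite mulr_ge0 // sumr_ge0 // => j _; rewrite mulr_ge0.
- move=> j; rewrite marginal_expect expect_move.
  rewrite (_ : expect P _ = expect P (fun w => K (w x) j)); last first.
    apply: eq_bigr => w _; congr (_ * _).
    rewrite (bigD1 j) //= ffunE !eqxx mulr1 big1 ?addr0 // => i /negbTE ij.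
    by rewrite ffunE eqxx ij mulr0.
  rewrite (expect_coord P x (fun i => K i j)).
  under eq_bigr do rewrite mulrDr; rewrite big_split /=.
  rewrite (bigD1 j) //= eqxx mul1r big1 ?addr0; last first.
    by move=> i /negbTE ->; rewrite mul0r mulr0.
  under eq_bigr do rewrite mulrA; rewrite -mulr_suml.
  under eq_bigr do rewrite mth; rewrite deficit_sym // -/D mulrBr mulr1 mth.
  rewrite /q [D * _]mulrC divfK // -/m.
  by case: (leP 0 (m j - mu j)); case: (leP 0 (mu j - m j)); lra.
- move=> y j yx; rewrite !marginal_expect expect_move; apply: eq_bigr => w _.
  congr (_ * _); under eq_bigr do rewrite ffunE (negbTE yx).
  by rewrite -mulr_suml K1 mul1r.
- rewrite expect_move.
  rewrite (_ : L * D = expect P (fun w => L * th (w x))); last first.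
    rewrite (expect_coord P x (fun i => L * th i)) /D -deficit_sym // mulr_sumr.
    by apply: eq_bigr => j _; rewrite -mth mulrCA.
  rewrite /expect -big_split /=; apply: ler_sum => w _.
  rewrite -mulrDr; apply: ler_wpM2l => //.
  have cK : \sum_j K (w x) j * c (upd w x j) =
      (1 - th (w x)) * c w + th (w x) * \sum_j q j * c (upd w x j).
    rewrite (Ksum (w x) (fun j => c (upd w x j))); congr (_ * c _ + _).
    by apply/ffunP => y; rewrite ffunE; case: eqP => // ->.
  rewrite cK.
  have : \sum_j q j * c (upd w x j) <= \sum_j q j * (c w + L).
    by apply: ler_sum => j _; apply: ler_wpM2l.
  rewrite -mulr_suml q1 mul1r => /(ler_wpM2l (th0 (w x))) h.
  apply: (le_trans (lerD (lexx _) h)).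
  by rewrite mulrDr mulrBl mul1r [L * _]mulrC addrA subrK.
Qed.

Lemma repair P (mu : I -> 'I_n -> F) c (L : I -> F) :
  is_prob P -> (forall x, is_prob (mu x)) ->
  (forall w x j, c (upd w x j) <= c w + L x) ->
  exists P', [/\ is_prob P', forall x j, marginal P' x j = mu x j
    & expect P' c <= expect P c + \sum_x L x * deficit (mu x) (marginal P x)].
Proof.
move=> pP pmu hc.
suff [P' [pP' mi _ cP']] : exists P', [/\ is_prob P',
    forall x j, x \in enum I -> marginal P' x j = mu x j,
    forall x j, x \notin enum I -> marginal P' x j = marginal P x j
    & expect P' c <= expect P c + \sum_(x <- enum I) L x * deficit (mu x) (marginal P x)].
  exists P'; split=> //; first by move=> x j; apply: mi; rewrite mem_enum.
  by move: cP'; rewrite big_enum.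
elim: (enum I) (enum_uniq I) => [_|x s IH /= /andP [xs us]].
  by exists P; split=> //; rewrite big_nil addr0.
have [P1 [pP1 in1 out1 c1]] := IH us.
have [P2 [pP2 mx my c2]] := repair_one pP1 (pmu x) (fun w => hc w x).
exists P2; split=> //.
- move=> y j; rewrite inE; have [-> _|yx /= ys] := eqVneq y x; first exact: mx.
  by rewrite my // in1.
- move=> y j; rewrite inE negb_or => /andP [yx ys].
  by rewrite my // out1.
- have gx : deficit (mu x) (marginal P1 x) = deficit (mu x) (marginal P x).
    by apply: eq_bigr => j _; rewrite out1.
  by rewrite gx in c2; rewrite big_cons; lra.
Qed.

(** Under a law with marginals mu, the expected price of a scenario is the
sum of all mu * p, whatever the coupling. *)
Lemma weak_duality P (mu p : I -> 'I_n -> F) c g :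
  is_prob P -> (forall x j, marginal P x j = mu x j) ->
  (forall w, g <= c w - \sum_x p x (w x)) ->
  \sum_x \sum_j mu x j * p x j + g <= expect P c.
Proof.
move=> [P0 P1] hm hg.
have -> : \sum_x \sum_j mu x j * p x j = expect P (fun w => \sum_x p x (w x)).
  rewrite /expect; under [RHS]eq_bigr do rewrite mulr_sumr.
  rewrite [RHS]exchange_big /=; apply: eq_bigr => x _.
  rewrite -/(expect P (fun w => p x (w x))) (expect_coord P x (p x)).
  by apply: eq_bigr => j _; rewrite hm.
rewrite -[g]mul1r -P1 mulr_suml /expect -big_split /=; apply: ler_sum => w _.
by rewrite -mulrDr; apply: ler_wpM2l => //; rewrite addrC -lerBrDr.
Qed.

End Coupling.

(** * Subgradient ascent *)

Section Ascent.

Variables (F : realFieldType) (J : finType) (eta : F) (g p : nat -> J -> F).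
Hypothesis p0 : forall z, p 0%N z = 0.
Hypothesis pS : forall t z, p t.+1 z = p t z + eta * g t z.

Definition dot (u v : J -> F) : F := \sum_z u z * v z.

(** Expand the squared distance from the iterate to q, step by step; it is
nonnegative after T steps. *)
Lemma ascent_regret (q : J -> F) T :
  2 * eta * \sum_(t < T) dot (g t) q <=
  dot q q + 2 * eta * \sum_(t < T) dot (g t) (p t)
          + eta ^+ 2 * \sum_(t < T) dot (g t) (g t).
Proof.
suff H : \sum_z (p T z - q z) ^+ 2 =
    dot q q + 2 * eta * \sum_(t < T) dot (g t) (p t)
    + eta ^+ 2 * \sum_(t < T) dot (g t) (g t)
    - 2 * eta * \sum_(t < T) dot (g t) q.
  by rewrite -subr_ge0 -H sumr_ge0 // => z _; rewrite sqr_ge0.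
elim: T => [|T IH].
  rewrite !big_ord0 !mulr0 !addr0 subr0; apply: eq_bigr => z _.
  by rewrite p0; ring.
have -> : \sum_z (p T.+1 z - q z) ^+ 2 = \sum_z (p T z - q z) ^+ 2
    + 2 * eta * dot (g T) (p T) + eta ^+ 2 * dot (g T) (g T)
    - 2 * eta * dot (g T) q.
  rewrite /dot !mulr_sumr -!big_split -sumrB /=.
  by apply: eq_bigr => z _; rewrite pS; ring.
by rewrite IH !big_ord_recr /=; ring.
Qed.

End Ascent.

(** Here c is the payoff, ct its rounded version, w t the scenario that
minimizes the rounded payoff minus prices at iteration t, and p t the prices. *)
Section Value.

Variables (F : realFieldType) (I : finType) (n : nat).
Local Notation scen := {ffun I -> 'I_n}.
Variables (mu : I -> 'I_n -> F) (c ct : scen -> F) (L : I -> F).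
Variables (S delta eta : F) (T : nat) (w : nat -> scen).
Variable p : nat -> I -> 'I_n -> F.
Hypothesis T0 : (0 < T)%N.
Hypothesis eta0 : 0 < eta.
Hypothesis pmu : forall x, is_prob (mu x).
Hypothesis c_upd : forall v x j, c (upd v x j) <= c v + L x.
Hypothesis LS : forall x, L x <= S.
Hypothesis S0 : 0 <= S.
Hypothesis c_ct : forall v, c v <= ct v + delta.
Hypothesis p0 : forall x j, p 0%N x j = 0.
Hypothesis pS : forall t x j,
  p t.+1 x j = p t x j + eta * (mu x j - (w t x == j)%:R).

Let empirical (v : scen) : F := (\sum_(t < T) (w t == v)%:R) / T%:R.

Let TF : T%:R != 0 :> F.
Proof. by rewrite pnatr_eq0 -lt0n. Qed.

Let expect_empirical f : expect empirical f = (\sum_(t < T) f (w t)) / T%:R.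
Proof.
rewrite /expect /empirical.
under eq_bigr do rewrite mulrAC mulr_suml.
rewrite -mulr_suml exchange_big /=; congr (_ / _); apply: eq_bigr => t _.
rewrite (bigD1 (w t)) //= eqxx mul1r big1 ?addr0 // => v.
by rewrite eq_sym => /negbTE ->; rewrite mul0r.
Qed.

Let prob_empirical : is_prob empirical.
Proof.
split=> [v|]; first by rewrite divr_ge0 ?ler0n // sumr_ge0.
have := expect_empirical (fun=> 1); rewrite /expect.
under eq_bigr do rewrite mulr1; move=> ->.
by rewrite sumr_const card_ord divff.
Qed.

(** A coordinate of the difference of two probability vectors is at most 1 in
absolute value, hence its square is at most the sum of the two entries. *)
Lemma step_norm x v : \sum_j (mu x j - (v == j)%:R) ^+ 2 <= 2.
Proof.
have [m0 m1] := pmu x.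
have -> : 2 = \sum_j (mu x j + (v == j)%:R).
  rewrite big_split /= m1 (bigD1 v) //= eqxx big1 ?addr0 // => j.
  by rewrite eq_sym => /negbTE ->.
apply: ler_sum => j _.
have mj1 : mu x j <= 1 by rewrite -m1 (bigD1 j) //= lerDl sumr_ge0.
have mj0 := m0 j; case: eqP => _ /=; rewrite ?mulr1n ?mulr0n; nra.
Qed.

(** Compare the ascent with the point q equal to S on the atoms where the
empirical law of the w t has too little mass and to 0 elsewhere: its inner
product with the average subgradient is S times the total deficit, which pays
for repairing the empirical law. *)
Lemma ascent_value : exists P', [/\ is_prob P',
  forall x j, marginal P' x j = mu x j &
  expect P' c <=
    (\sum_(t < T) (\sum_x \sum_j mu x j * p t x j
                   + (ct (w t) - \sum_x p t x (w t x)))) / T%:R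
    + delta + S ^+ 2 * #|I|%:R * n%:R / (2 * eta * T%:R) + eta * #|I|%:R].
Proof.
have [P' [pP' mP' cP']] := repair prob_empirical pmu c_upd.
exists P'; split=> //; apply: (le_trans cP').
pose D := \sum_x deficit (mu x) (marginal empirical x).
have D_le : \sum_x L x * deficit (mu x) (marginal empirical x) <= S * D.
  rewrite /D mulr_sumr; apply: ler_sum => x _; apply: ler_wpM2r => //.
  by apply: sumr_ge0 => j _; rewrite le_max lexx.
have e_le : expect empirical c <= (\sum_(t < T) ct (w t)) / T%:R + delta.
  rewrite expect_empirical.
  apply: (@le_trans _ _ ((\sum_(t < T) (ct (w t) + delta)) / T%:R)).
    by rewrite ler_wpM2r ?invr_ge0 ?ler0n // ler_sum.
  rewrite big_split /= sumr_const card_ord mulrDl -[delta *+ T]mulr_natr.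
  by rewrite mulfK.
pose J : finType := (I * 'I_n)%type.
pose g t (z : J) := mu z.1 z.2 - (w t z.1 == z.2)%:R.
pose q (z : J) := if marginal empirical z.1 z.2 < mu z.1 z.2 then S else 0.
have H := @ascent_regret F J eta g (fun t z => p t z.1 z.2) (fun z => p0 _ _)
  (fun t z => pS t z.1 z.2) q T.
have gq : \sum_(t < T) dot (g t) q = T%:R * (S * D).
  have -> : D = \sum_(z : J) Num.max 0 (mu z.1 z.2 - marginal empirical z.1 z.2).
    by rewrite /D /deficit pair_bigA.
  rewrite /dot [LHS]exchange_big !mulr_sumr /=.
  apply: eq_bigr => -[x j] _ /=; rewrite -mulr_suml /g /= sumrB.
  rewrite sumr_const card_ord -[mu x j *+ T]mulr_natl.
  have -> : \sum_(t < T) (w t x == j)%:R = T%:R * marginal empirical x j.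
    by rewrite marginal_expect expect_empirical mulrC divfK.
  rewrite -mulrBr -mulrA; congr (_ * _); rewrite mulrC /q /=; case: ltP => h.
    by rewrite max_r // subr_ge0 ltW.
  by rewrite mul0r max_l ?mulr0 // subr_le0.
have qq : dot q q <= S ^+ 2 * #|I|%:R * n%:R.
  rewrite -mulrA -natrM -[n in (_ * n)%N]card_ord -card_prod.
  rewrite mulr_natr -sumr_const; apply: ler_sum => z _; rewrite /q expr2.
  by case: ifP => _ //; rewrite mulr0 mulr_ge0.
have gg t : dot (g t) (g t) <= 2 * #|I|%:R.
  rewrite /dot -(pair_bigA _ (fun x j => g t (x, j) * g t (x, j))) /=.
  rewrite mulr_natr -sumr_const; apply: ler_sum => x _.
  by have := step_norm x (w t x); rewrite /g /=; under eq_bigr do rewrite expr2.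
have ggs : \sum_(t < T) dot (g t) (g t) <= T%:R * (2 * #|I|%:R).
  by rewrite mulr_natl -[X in _ *+ X]card_ord -sumr_const ler_sum.
pose G := \sum_(t < T) dot (g t) (fun z => p t z.1 z.2).
have gp : \sum_(t < T) (\sum_x \sum_j mu x j * p t x j
            + (ct (w t) - \sum_x p t x (w t x))) = G + \sum_(t < T) ct (w t).
  rewrite /G -big_split /=; apply: eq_bigr => t _.
  rewrite addrA addrAC; congr (_ + _).
  rewrite /dot -(pair_bigA _ (fun x j => g t (x, j) * p t x j)) /= -sumrB.
  apply: eq_bigr => x _; rewrite /g /=; under [RHS]eq_bigr do rewrite mulrBl.
  rewrite sumrB; congr (_ - _).
  rewrite (bigD1 (w t x)) //= eqxx mul1r big1 ?addr0 // => j.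
  by rewrite eq_sym => /negbTE ->; rewrite mul0r.
rewrite gp; rewrite gq -/G in H.
have Tp : 0 < T%:R :> F by rewrite ltr0n.
have SD : S * D <= S ^+ 2 * #|I|%:R * n%:R / (2 * eta * T%:R) + G / T%:R
    + eta * #|I|%:R.
  have ep : 0 < 2 * eta * T%:R by rewrite !mulr_gt0.
  rewrite -(ler_pM2l ep) !mulrDr.
  have -> : 2 * eta * T%:R * (S ^+ 2 * #|I|%:R * n%:R / (2 * eta * T%:R)) =
      S ^+ 2 * #|I|%:R * n%:R by rewrite mulrC divfK // gt_eqF.
  have -> : 2 * eta * T%:R * (G / T%:R) = 2 * eta * G.
    by rewrite -mulrA [T%:R * _]mulrC divfK.
  have -> : 2 * eta * T%:R * (S * D) = 2 * eta * (T%:R * (S * D)) by ring.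
  apply: (le_trans H); apply: lerD; first by rewrite lerD2r.
  have := ler_wpM2l (sqr_ge0 eta) ggs; congr (_ <= _); ring.
rewrite [(G + _) / _]mulrDl; lra.
Qed.

End Value.

(** * Linear programs *)

Section Minimizer.

Import boolp classical_sets topology normedtype derive.
Import numFieldNormedType.Exports.
Local Open Scope classical_set_scope.
Variables (R : realType) (T E : finType) (A : E -> T -> R) (b : E -> R) (c : T -> R).

Definition feasible (P : T -> R) : Prop :=
  [/\ forall t, 0 <= P t, \sum_t P t = 1 & forall e, \sum_t A e t * P t = b e].

Let point (x : 'rV[R]_#|T|) (t : T) : R := x ord0 (enum_rank t).

Let linear_continuous (a : T -> R) :
  continuous (fun x : 'rV[R]_#|T| => \sum_t a t * point x t).
Proof.
apply: (@continuous_big _ _ _ _ xpredT); first exact: add_continuous.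
move=> t _ x; apply: (@continuous_comp _ _ _ (fun x => point x t) ( *%R (a t))).
  exact: coord_continuous.
exact: mulrl_continuous.
Qed.

Let level_closed (a : T -> R) y : closed [set x | \sum_t a t * point x t = y].
Proof.
apply: (preimage_closed (f := fun x => \sum_t a t * point x t) (D := [set y])).
  by move=> x _; exact: linear_continuous.
exact: closed_eq.
Qed.

(** The feasible vectors form a closed subset of a cube. *)
Lemma minimizer_exists : (exists P, feasible P) ->
  exists2 P, feasible P &
    forall P', feasible P' -> \sum_t c t * P t <= \sum_t c t * P' t.
Proof.
move=> [P0 fP0].
pose V : set 'rV[R]_#|T| := [set x | feasible (point x)].
have pointK P : point (\row_j P (enum_val j)) = P.
  by apply: funext => t; rewrite /point mxE enum_rankK.
have Vclosed : closed V.
  have -> : V = (\bigcap_(t in setT) [set x | 0 <= point x t]) `&`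
      ([set x | \sum_t 1 * point x t = 1] `&`
       \bigcap_(e in setT) [set x | \sum_t A e t * point x t = b e]).
    apply/seteqP; split=> x /=.
      move=> [h0 h1 hA]; split; first by move=> t _; exact: h0.
      split; last by move=> e _; exact: hA.
      by under eq_bigr do rewrite mul1r.
    move=> [h0 [h1 hA]]; split; [by move=> t; exact: h0| |by move=> e; exact: hA].
    by rewrite -h1; under [RHS]eq_bigr do rewrite mul1r.
  apply: closedI; last first.
    by apply: closedI; [|apply: closed_bigI => e _]; exact: level_closed.
  apply: closed_bigI => t _.
  apply: (preimage_closed (f := fun x => point x t) (D := [set y | 0 <= y])).
    by move=> x _; exact: coord_continuous.
  exact: closed_ge.
have Vcompact : compact V.
  have cube : compact
      [set x : 'rV[R]_#|T| | forall i, `[(0 : R), 1] (x ord0 i)].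
    apply: (@rV_compact R _ (fun=> `[(0 : R), 1])).
    by move=> _; exact: segment_compact.
  apply: subclosed_compact Vclosed cube _ => x [h0 h1 _] i /=; have := h0 (enum_val i).
  rewrite /point enum_valK in_itv /= => -> /=.
  rewrite -h1 (bigD1 (enum_val i)) //= /point enum_valK lerDl.
  by apply: sumr_ge0 => t _; exact: h0.
have V0 : V !=set0.
  by exists (\row_j P0 (enum_val j)); rewrite /V /= pointK.
have [x xV xmin] := compact_EVT_min V0 Vcompact
  (@continuous_subspaceT _ _ V _ (linear_continuous (a := c))).
exists (point x); first by move: xV; rewrite inE.
move=> P' fP'; have := xmin (\row_j P' (enum_val j)).
by rewrite pointK; apply; rewrite inE /V /= pointK.
Qed.

End Minimizer.

(** * The market *)

Section MarketGame.

Variables (k r n : nat) (mu : 'I_k -> 'I_r -> law) (eps : rat).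
Hypothesis laws : forall i l, is_law n (mu i l).
Hypothesis nonneg : forall i l, nonneg_atoms (mu i l).
Hypothesis eps0 : 0 < eps.

Local Notation scen := (scenario k r n).
Let a (l i j : nat) : rat := (entry mu i l j).1.
Let m (l i j : nat) : rat := (entry mu i l j).2.

Lemma entryE (i : 'I_k) (l : 'I_r) j : entry mu i l j = nth (0, 0) (mu i l) j.
Proof. by rewrite /entry !valK. Qed.

(** Positions beyond the end of a law read as atom 0 of weight 0, so the program
can treat all laws as having n atoms. *)
Lemma entry_out i l j : (n <= j)%N -> entry mu i l j = (0, 0).
Proof.
rewrite /entry => nj; case: insubP => // i' _ _; case: insubP => // l' _ _.
by rewrite nth_default //; case: (laws i' l') => h _ _ _; exact: leq_trans nj.
Qed.

Lemma atom_ge0 l i j : 0 <= a l i j.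
Proof.
rewrite /a /entry; case: insubP => // i' _ _; case: insubP => // l' _ _.
case: (ltnP j (size (mu i' l'))) => h; last by rewrite nth_default.
by have /allP := nonneg i' l'; apply; apply: mem_nth.
Qed.

Lemma law_prob (i : 'I_k) (l : 'I_r) : is_prob (fun j : 'I_n => m l i j).
Proof.
have [sn _ pos s1] := laws i l; rewrite /m.
split=> [j|]; rewrite ?entryE.
  case: (ltnP j (size (mu i l))) => h; last by rewrite nth_default.
  by apply/ltW; have /allP := pos; apply; apply: mem_nth.
rewrite -[RHS]s1 (big_nth (0, 0)) big_mkord.
rewrite (big_ord_widen n (fun j => (nth (0, 0) (mu i l) j).2) sn) [RHS]big_mkcond /=.
apply: eq_bigr => j _; rewrite entryE; case: ltnP => // h.
by rewrite nth_default.
Qed.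

Lemma law_nonempty (i : 'I_k) (l : 'I_r) : (0 < size (mu i l))%N.
Proof.
have [_ _ _ s1] := laws i l; case: (mu i l) s1 => //.
by rewrite big_nil => /esym/eqP; rewrite oner_eq0.
Qed.

Lemma input_market_loaded : market_loaded k r n a m eps (input n mu eps).
Proof.
split=> // i l j ik lr jn; rewrite /= /a /m.
have n0 : (0 < n)%N by exact: leq_ltn_trans jn.
have r0 : (0 < r)%N by exact: leq_ltn_trans lr.
by rewrite divnMDl // modnMDl (divn_small jn) (modn_small jn) addn0 divnMDl //
           modnMDl (divn_small lr) (modn_small lr) addn0.
Qed.

Local Notation mx := (maxatom n a).
Local Notation sh := (share n a).
Local Notation sc := (scale k n a).

Lemma share_bounds l i j : 0 <= sh l i j <= 1.
Proof.
rewrite /share; have m0 := maxupto_ge0 (a l i) n.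
rewrite divr_ge0 ?atom_ge0 //=.
have [e|ne] := eqVneq (mx l i) 0; first by rewrite e invr0 mulr0.
rewrite ler_pdivrMr ?mul1r; last by rewrite lt_neqAle eq_sym ne.
case: (ltnP j n) => jn; first exact: maxupto_ge.
by rewrite /a entry_out.
Qed.

Lemma atom_share l i j : (j < n)%N -> a l i j = mx l i * sh l i j.
Proof.
move=> jn; rewrite /share; have [e|ne] := eqVneq (mx l i) 0.
  rewrite e mul0r; apply/eqP; rewrite eq_le atom_ge0 andbT -e.
  exact: maxupto_ge.
by rewrite mulrC divfK.
Qed.

Lemma scale_ge0 l : 0 <= sc l.
Proof. by apply: prodr_ge0 => i _; exact: maxupto_ge0. Qed.

Lemma payoffE (v : scen) :
  payoff mu v = \sum_(l < r) sc l * \prod_(i < k) sh l i (v (i, l)).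
Proof.
apply: eq_bigr => l _; rewrite /scale -big_split /=; apply: eq_bigr => i _.
by rewrite -atom_share // /a entryE.
Qed.

Lemma share_prod_bounds l (w : 'I_k -> nat) :
  0 <= \prod_(i < k) sh l i (w i) <= 1.
Proof.
rewrite prodr_ge0 /=; last by move=> i _; case/andP: (share_bounds l i (w i)).
have : \prod_(i < k) sh l i (w i) <= \prod_(i < k) 1.
  by apply: ler_prod => i _; exact: share_bounds.
by rewrite big1_eq.
Qed.

(** Only the product of stock x.2 changes, and it stays between 0 and the
scale. *)
Lemma payoff_upd (v : scen) x j :
  payoff mu (upd v x j) <= payoff mu v + sc x.2.
Proof.
rewrite !payoffE (bigD1 x.2) //= [X in _ <= X + _](bigD1 x.2) //=.
have -> : \sum_(l < r | l != x.2) sc l * \prod_(i < k) sh l i (upd v x j (i, l))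
    = \sum_(l < r | l != x.2) sc l * \prod_(i < k) sh l i (v (i, l)).
  apply: eq_bigr => l lx; congr (_ * _); apply: eq_bigr => i _; rewrite ffunE.
  by case: eqP => // e; rewrite -e eqxx in lx.
have /andP [p0 p1] := share_prod_bounds x.2 (fun i => v (i, x.2)).
have /andP [q0 q1] := share_prod_bounds x.2 (fun i => upd v x j (i, x.2)).
have s0 := scale_ge0 x.2.
by have := mulr_ge0 s0 p0; have := ler_piMr s0 q1; lra.
Qed.

(** Choosing the largest atom everywhere is admissible: should the maximum be
attained by the padding value 0, it is attained by an actual atom too. *)
Lemma total_le_Rmax : total k r n a <= Rmax n mu.
Proof.
have best (x : 'I_k * 'I_r) : exists j : 'I_n,
    (j < size (mu x.1 x.2))%N && (a x.2 x.1 j == mx x.2 x.1).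
  have sz := law_nonempty x.1 x.2; have [sn _ _ _] := laws x.1 x.2.
  have n0 : (0 < n)%N by exact: leq_trans sn.
  have [j jn ej] := maxupto_attained n0 (atom_ge0 x.2 x.1).
  case: (ltnP j (size (mu x.1 x.2))) => js.
    by exists (Ordinal jn); rewrite js ej eqxx.
  exists (Ordinal n0); rewrite sz /= eq_le maxupto_ge //= /maxatom -ej.
  by rewrite /a entryE nth_default // atom_ge0.
pose w : scen := [ffun x => xchoose (best x)].
have wadm : admissible mu w.
  apply/forallP => i; apply/forallP => l; rewrite ffunE.
  by case/andP: (xchooseP (best (i, l))).
have -> : total k r n a = payoff mu w.
  apply: eq_bigr => l _; apply: eq_bigr => i _; rewrite ffunE.
  case/andP: (xchooseP (best (i, l))) => _ /eqP /= e.
  by rewrite /atom -entryE; exact: esym e.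
exact: le_bigmax_cond.
Qed.

Lemma total_ge0 : 0 <= total k r n a.
Proof. by apply: sumr_ge0 => l _; exact: scale_ge0. Qed.

Lemma scale_le_total (l : 'I_r) : sc l <= total k r n a.
Proof.
rewrite /total (bigD1 l) //= lerDl; apply: sumr_ge0 => l' _; exact: scale_ge0.
Qed.

Variables (A N T : nat).
Hypothesis Alarge : total k r n a <= A%:R * eps.
Hypothesis NE : N = (8 * A.+1 * k.+1 * r.+1 * n.+1)%N.
Hypothesis TE : T = (N * N * N)%N.

Let dl l t : nat -> nat -> rat := dual k n a m eps N l t.
(** The choices of v for stock l, extended by a default to all years in nat, as
the dynamic program is indexed by nat. *)
Let positions (v : scen) (l : 'I_r) (i : nat) : nat :=
  if insub i is Some i' then v (i', l) else 0%N.
(** The payoff that the dynamic programs minimize exactly. *)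
Definition rounded (v : scen) : rat :=
  \sum_(l < r) sc l / N%:R * (chain N (sh l) (positions v l) k N)%:R.

Let N0 : (0 < N)%N. Proof. by rewrite NE !muln_gt0. Qed.
Let NR0 : 0 < N%:R :> rat. Proof. by rewrite ltr0n. Qed.

Lemma positionsE (v : scen) l (i : 'I_k) : positions v l i = v (i, l).
Proof. by rewrite /positions valK. Qed.

Lemma chain_payoff (v : scen) (l : 'I_r) :
  sc l * \prod_(i < k) sh l i (v (i, l)) - k%:R * sc l / N%:R
    <= sc l / N%:R * (chain N (sh l) (positions v l) k N)%:R
    <= sc l * \prod_(i < k) sh l i (v (i, l)).
Proof.
have /andP [h1 h2] := chain_bounds (share_bounds l) (positions v l) k (leqnn N).
move: h1 h2; under eq_bigr do rewrite positionsE.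
have s0 : 0 <= sc l / N%:R by rewrite divr_ge0 ?scale_ge0.
move=> /(ler_wpM2l s0) h1 /(ler_wpM2l s0) h2.
have e q : sc l / N%:R * (N%:R * q) = sc l * q.
  by rewrite mulrA divfK // gt_eqF.
by move: h1 h2; rewrite mulrBr !e => h1 ->; rewrite andbT;
   apply: le_trans h1; rewrite lerB // mulrAC [k%:R * _]mulrC.
Qed.

Lemma rounded_le v : rounded v <= payoff mu v.
Proof.
by rewrite payoffE; apply: ler_sum => l _; case/andP: (chain_payoff v l).
Qed.

Lemma payoff_le_rounded v :
  payoff mu v <= rounded v + k%:R * total k r n a / N%:R.
Proof.
rewrite payoffE /total mulr_sumr mulr_suml -big_split /=; apply: ler_sum => l _.
by rewrite -lerBlDr; case/andP: (chain_payoff v l).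
Qed.

Lemma n_gt0 (x : 'I_k * 'I_r) : (0 < n)%N.
Proof.
have [sn _ _ _] := laws x.1 x.2; apply: leq_trans sn; exact: law_nonempty.
Qed.

Definition answer (t : nat) : scen :=
  [ffun x : 'I_k * 'I_r => Ordinal
     (best_path_lt N (sh x.2) (sc x.2) (dl x.2 t) k N x.1 (n_gt0 x))].

Let p t (x : 'I_k * 'I_r) (j : 'I_n) : rat := dl x.2 t x.1 j.

Lemma dual_succ t (x : 'I_k * 'I_r) (j : 'I_n) : p t.+1 x j =
  p t x j + eps / N%:R * (m x.2 x.1 j - (answer t x == j)%:R).
Proof. by rewrite /answer ffunE /p /dl /dual iterS /dual_update /step_size; ring. Qed.

Lemma gain_split t : \sum_(l < r) gain k n a m eps N l t =
  \sum_(x : 'I_k * 'I_r) \sum_(j < n) m x.2 x.1 j * p t x j +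
  (rounded (answer t) - \sum_x p t x (answer t x)).
Proof.
rewrite /gain /dual_value big_split /= addrC; congr (_ + _).
  rewrite exchange_big /= pair_bigA.
  by apply: eq_bigr => -[i l] _.
have -> : \sum_x p t x (answer t x) =
    \sum_(l < r) \sum_(i < k) p t (i, l) (answer t (i, l)).
  by rewrite exchange_big /= pair_bigA; apply: eq_bigr => -[i l].
rewrite /rounded -sumrB; apply: eq_bigr => l _; rewrite table_best_path.
congr (_ * _%:R - _); last by apply: eq_bigr => i _; rewrite /p ffunE.
by apply: chain_ext => y yk; rewrite (positionsE _ _ (Ordinal yk)) ffunE.
Qed.

(** Payoff and prices are sums over stocks, and a scenario chooses for each stock
separately, so the minimum over scenarios is the sum of the minima over the
stocks. *)
Lemma answer_optimal t (v : scen) :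
  rounded (answer t) - \sum_x p t x (answer t x) <=
  rounded v - \sum_x p t x (v x).
Proof.
have flip (u : scen) : \sum_x p t x (u x) =
    \sum_(l < r) \sum_(i < k) p t (i, l) (u (i, l)).
  by rewrite exchange_big /= pair_bigA; apply: eq_bigr => -[i l].
rewrite !flip /rounded -!sumrB; apply: ler_sum => l _.
have -> : sc l / N%:R * (chain N (sh l) (positions (answer t) l) k N)%:R
    - \sum_(i < k) p t (i, l) (answer t (i, l)) =
    table n N (sh l) (sc l) (dl l t) k N.
  rewrite table_best_path; congr (_ * _%:R - _); last first.
    by apply: eq_bigr => i _; rewrite /p ffunE.
  by apply: chain_ext => y yk; rewrite (positionsE _ _ (Ordinal yk)) ffunE.
have h := @table_le n N (sh l) (sc l) (dl l t) (positions v l) k N _.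
apply: le_trans (h _) _.
  by move=> y yk; rewrite (positionsE _ _ (Ordinal yk)).
by under eq_bigr do rewrite positionsE.
Qed.

Definition estimate : rat :=
  (\sum_(l < r) \sum_(t < T) gain k n a m eps N l t) / T%:R.

Let T0 : (0 < T)%N. Proof. by rewrite TE !muln_gt0 N0. Qed.

(** The three terms are the rounding error, the initial distance to the
comparison point and the accumulated squared steps; each is at most
eps / 8. *)
Lemma error_le :
  k%:R * total k r n a / N%:R +
  total k r n a ^+ 2 * #|{: 'I_k * 'I_r}|%:R * n%:R / (2 * (eps / N%:R) * T%:R) +
  eps / N%:R * #|{: 'I_k * 'I_r}|%:R <= eps.
Proof.
rewrite card_prod !card_ord natrM TE !natrM.
set S := total k r n a; set x : rat := N%:R.
have x0 : 0 < x := NR0.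
have S0 : 0 <= S := total_ge0.
have nat_le u v : (u <= v)%N -> u%:R <= v%:R :> rat by rewrite ler_nat.
have le_pm u v : (0 < v -> u <= u.+1 * v)%N.
  by move=> v0; apply: leq_trans (leqnSn u) (leq_pmulr _ v0).
have NAk : 8 * (A%:R * k%:R) <= x.
  rewrite -!natrM; apply: nat_le; rewrite NE -!mulnA !leq_mul //.
  exact: le_pm.
have Nkr : 8 * (k%:R * r%:R) <= x.
  rewrite -!natrM; apply: nat_le; rewrite NE -!mulnA leq_mul //.
  rewrite -[X in (X <= _)%N]mul1n leq_mul // leq_mul //.
  exact: le_pm.
have NA : A%:R * A%:R * (8 * (k%:R * r%:R * n%:R)) <= x * x.
  rewrite -!natrM; apply: nat_le.
  apply: (@leq_trans (A * (A * (8 * (k * r * n))))); first by rewrite -[leqLHS]mulnA.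
  have h : (A * (8 * (k * r * n)) <= N)%N.
    rewrite NE mulnCA -!mulnA. by rewrite !leq_mul.
  apply: leq_mul h; rewrite NE -!mulnA mulnCA; exact: le_pm.
have SA : S * S <= A%:R * A%:R * (eps * eps).
  by rewrite mulrACA; apply: ler_pM.
have e1 : k%:R * S / x <= eps / 8.
  rewrite ler_pdivrMr //.
  apply: (@le_trans _ _ (k%:R * (A%:R * eps))); first exact: ler_wpM2l.
  by have := ler_wpM2l (ltW eps0) NAk; lra.
have e2 : eps / x * (k%:R * r%:R) <= eps / 8.
  rewrite mulrAC ler_pdivrMr //.
  by have := ler_wpM2l (ltW eps0) Nkr; lra.
have e3 : S ^+ 2 * (k%:R * r%:R) * n%:R / (2 * (eps / x) * (x * x * x)) <= eps / 8.
  have -> : 2 * (eps / x) * (x * x * x) = 2 * eps * (x * x).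
    by field; rewrite gt_eqF.
  rewrite ler_pdivrMr ?mulr_gt0 //.
  have h1 := ler_wpM2l (mulr_ge0 (ltW eps0) (ltW eps0)) NA.
  have h2 : S * S * (k%:R * r%:R * n%:R) <=
      A%:R * A%:R * (eps * eps) * (k%:R * r%:R * n%:R).
    by rewrite ler_wpM2r // !mulr_ge0.
  have : 0 <= eps * eps * (x * x) by rewrite !mulr_ge0 // ltW.
  by rewrite expr2; lra.
apply: (le_trans (lerD (lerD e1 e3) e2)); have := eps0; lra.
Qed.

Lemma sum_gain : \sum_(l < r) \sum_(t < T) gain k n a m eps N l t =
  \sum_(t < T) (\sum_(x : 'I_k * 'I_r) \sum_(j < n) m x.2 x.1 j * p t x j +
    (rounded (answer t) - \sum_x p t x (answer t x))).
Proof. by rewrite exchange_big; apply: eq_bigr => t _; exact: gain_split. Qed.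

Lemma near_optimal : exists P : scen -> rat, [/\ is_prob P,
  forall x j, marginal P x j = m x.2 x.1 j
  & expect P (payoff mu) <= estimate + eps].
Proof.
have eta0 : 0 < eps / N%:R by rewrite divr_gt0.
have [P [pP mP cP]] := ascent_value T0 eta0 (fun x => law_prob x.1 x.2)
  payoff_upd (fun x => scale_le_total x.2) total_ge0 payoff_le_rounded
  (fun x j => erefl 0 : p 0 x j = 0) dual_succ.
exists P; split=> //; apply: (le_trans cP).
rewrite /estimate sum_gain -!addrA lerD2l !addrA; exact: error_le.
Qed.

(** Weak duality holds at every iterate, so also for the average. *)
Lemma estimate_le (R : realType) (P : scen -> R) : is_joint mu P ->
  ratr estimate <= expected_profit mu P.
Proof.
move=> [P0 P1 mP].
have step t : ratr (\sum_(x : 'I_k * 'I_r) \sum_(j < n) m x.2 x.1 j * p t x j +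
    (rounded (answer t) - \sum_x p t x (answer t x))) <= expected_profit mu P.
  have := answer_optimal t; move: (rounded (answer t) - _) => q opt.
  rewrite raddfD /= raddf_sum.
  have -> : \sum_(x : 'I_k * 'I_r) ratr (\sum_(j < n) m x.2 x.1 j * p t x j) =
      \sum_(x : 'I_k * 'I_r) \sum_(j < n) ratr (m x.2 x.1 j) * ratr (p t x j) :> R.
    apply: eq_bigr => x _; rewrite raddf_sum; apply: eq_bigr => j _.
    by rewrite /= rmorphM.
  apply: (@weak_duality R _ n P (fun x j => ratr (m x.2 x.1 j))
    (fun x j => ratr (p t x j)) (fun v => ratr (payoff mu v)) _ (conj P0 P1)).
    by move=> [i l] j; rewrite /marginal mP /m entryE.
  move=> v; rewrite -raddf_sum -raddfB ler_rat.
  by apply: (le_trans (opt v)); rewrite lerB // rounded_le.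
rewrite /estimate sum_gain fmorph_div rmorph_nat ler_pdivrMr ?ltr0n //.
rewrite raddf_sum mulr_natr -[X in _ *+ X]card_ord -sumr_const.
by apply: ler_sum => t _; exact: step.
Qed.

End MarketGame.

(** * Existence and approximation of the worst case *)

Lemma worst_case_exists (R : realType) k r n (mu : 'I_k -> 'I_r -> law) :
  (exists P : scenario k r n -> R, is_joint mu P) ->
  exists2 P : scenario k r n -> R, is_joint mu P &
    is_worst_case n mu (expected_profit mu P).
Proof.
pose E : Type := ('I_k * 'I_r * 'I_n)%type.
pose A (e : E) (w : scenario k r n) : R := (w e.1 == e.2)%:R.
pose b (e : E) : R := ratr (weight (mu e.1.1 e.1.2) e.2).
have joint_feasible P : is_joint mu P <-> feasible A b P.
  have sumE (e : E) : \sum_w A e w * P w =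
      \sum_(w : scenario k r n | w e.1 == e.2) P w.
    rewrite [RHS]big_mkcond; apply: eq_bigr => w _; rewrite /A.
    by case: eqP => _; rewrite ?mul1r ?mul0r.
  split=> -[P0 P1 mP]; split=> //.
    by move=> [[i l] j]; rewrite sumE mP.
  by move=> i l j; have := mP (i, l, j); rewrite sumE.
move=> [P0 /joint_feasible fP0].
have [P /joint_feasible jP minP] :=
  minimizer_exists (fun w => ratr (payoff mu w)) (ex_intro _ P0 fP0).
have swap (Q : scenario k r n -> R) :
    \sum_w ratr (payoff mu w) * Q w = expected_profit mu Q.
  by apply: eq_bigr => w _; rewrite mulrC.
exists P => //; split; first by exists P.
by move=> Q /joint_feasible /minP; rewrite !swap.
Qed.

Lemma grid_size_le (r k n A : nat) (rho : rat) : 0 <= rho -> A%:R <= rho + 1 ->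
  ((8 * A.+1 * k.+1 * r.+1 * n.+1) ^ 3).+1%:R
    <= (((16 * r.+1) ^ 3).+1)%:R * (n%:R + k%:R + rho + 1) ^+ 9.
Proof.
move=> rho0 Arho; set X : rat := n%:R + _ + _ + _.
have n0 : 0 <= n%:R :> rat by [].
have k0 : 0 <= k%:R :> rat by [].
have X1 : 1 <= X by rewrite /X; lra.
have X0 : 0 <= X by apply: le_trans X1.
have hA : A.+1%:R <= 2 * X by rewrite -natr1 /X; lra.
have hk : k.+1%:R <= X by rewrite -natr1 /X; lra.
have hn : n.+1%:R <= X by rewrite -natr1 /X; lra.
have hN : (8 * A.+1 * k.+1 * r.+1 * n.+1)%:R <= (16 * r.+1)%:R * X ^+ 3.
  rewrite !natrM (_ : 16%:R * r.+1%:R * X ^+ 3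
    = 8%:R * (2 * X) * X * r.+1%:R * X); last by ring.
  apply: ler_pM => //; first by rewrite !mulr_ge0.
  apply: ler_pM => //; first by rewrite !mulr_ge0.
  by apply: ler_pM => //; [rewrite mulr_ge0|apply: ler_wpM2l].
rewrite -[X in X%:R <= _]addn1 natrD -[X in _ <= X%:R * _]addn1 natrD mulrDl mul1r.
apply: lerD; last by rewrite exprn_ege1.
rewrite !natrX (_ : X ^+ 9 = (X ^+ 3) ^+ 3); last by rewrite -exprM.
by rewrite -exprMn lerXn2r // nnegrE // mulr_ge0 // exprn_ge0.
Qed.

Theorem corollary7p10 (R : realType) (r : nat) :
  exists prog : cmd,
  forall Cb db : nat, exists C d : nat,
  forall (k n : nat) (mu : 'I_k -> 'I_r -> law) (eps : rat),
    (forall i l, is_law n (mu i l)) ->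
    (forall i l, nonneg_atoms (mu i l)) ->
    (forall i l, law_bits_le (Cb * (n + k + 1) ^ db)%N (mu i l)) ->
    0 < eps ->
    exists (t : nat) (s : state),
      [/\ exec prog (input n mu eps) t s,
          t%:R <= C%:R * (n%:R + k%:R + Rmax n mu / eps + 1) ^+ d
        & exists2 v : R, is_worst_case n mu v
            & `|ratr (output s) - v| <= ratr eps].
Proof.
have [C0 [d0 time_le]] := time_bound_poly (program r).
exists (program r) => Cb db; exists (C0 * ((16 * r.+1) ^ 3).+1 ^ d0)%N, (9 * d0)%N.
move=> k n mu eps laws nonneg _ eps0.
pose a l i j := (entry mu i l j).1.
pose S := total k r n a.
have S0 : 0 <= S := total_ge0 n mu.
have exA : exists A, S <= A%:R * eps.
  exists (Num.bound (S / eps)); rewrite -ler_pdivrMr //.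
  by apply/ltW/archi_boundP; rewrite divr_ge0 // ltW.
have [A Alarge Amin] := ex_minnP exA.
have Asmall i : (i < A)%N -> i%:R * eps < S.
  by move=> iA; rewrite ltNge; apply/negP => /Amin; rewrite leqNgt iA.
pose N := (8 * A.+1 * k.+1 * r.+1 * n.+1)%N; pose T := (N * N * N)%N.
have N8 : (8 * A.+1 <= N)%N by rewrite /N -!mulnA leq_mul // leq_pmulr // !muln_gt0.
have NT : (N < T)%N.
  by rewrite /T -mulnA -[X in (X < _)%N]muln1 ltn_mul2l; apply/andP; split; nia.
have le_N u c : (0 < c)%N -> (u.+1 * c <= N)%N -> (u <= T)%N.
  by move=> c0 uN; have := leq_pmulr u.+1 c0; lia.
have kT : (k <= T)%N.
  apply: (le_N k (8 * A.+1 * r.+1 * n.+1)%N); first by rewrite !muln_gt0.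
  by apply: eq_leq; rewrite /N; ring.
have rT : (r <= T)%N.
  apply: (le_N r (8 * A.+1 * k.+1 * n.+1)%N); first by rewrite !muln_gt0.
  by apply: eq_leq; rewrite /N; ring.
have nT : (n <= T)%N.
  apply: (le_N n (8 * A.+1 * k.+1 * r.+1)%N); first by rewrite !muln_gt0.
  by apply: eq_leq; rewrite /N; ring.
have AT : (A <= T)%N by lia.
have n0 : (0 < r -> 0 < k -> 0 < n)%N.
  by move=> r0 k0; exact: (n_gt0 laws (Ordinal k0, Ordinal r0)).
have [t [s [run tT out]]] := wp_program kT rT nT Asmall Alarge (erefl N) (erefl T)
  AT NT (leqnn T) n0 (input_market_loaded n mu eps) erefl erefl erefl.
exists t, s; split=> //.
- have Srho : S / eps <= Rmax n mu / eps.
    by apply: ler_wpM2r; [rewrite invr_ge0 ltW|exact: total_le_Rmax].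
  have rho0 : 0 <= Rmax n mu / eps.
    by apply: le_trans Srho; rewrite divr_ge0 // ltW.
  have Arho : A%:R <= Rmax n mu / eps + 1.
    case: (posnP A) => [->|A0]; first by rewrite addr_ge0.
    have := Asmall A.-1; rewrite prednK // leqnn => /(_ isT).
    rewrite -ltr_pdivlMr // => /ltW /le_trans /(_ Srho).
    by move=> h; rewrite -(prednK A0) -natr1 lerD2r.
  have sz := grid_size_le r k n rho0 Arho.
  apply: (@le_trans _ _ (C0 * T.+1 ^ d0)%:R).
    by rewrite ler_nat; apply: leq_trans tT (time_le T).
  rewrite !natrM !natrX exprM -mulrA -exprMn; apply: ler_wpM2l => //.
  have TE : T = (N ^ 3)%N by rewrite /T !expnS expn0 muln1 mulnA.
  by rewrite lerXn2r ?nnegrE // ?TE // (le_trans _ sz).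
have [P [[P0 P1] mP cP]] :=
  near_optimal laws nonneg eps0 Alarge (erefl N) (erefl T).
have jP : is_joint mu (fun w => ratr (P w) : R).
  split=> [w||i l j]; first by rewrite ler0q.
    by rewrite -raddf_sum P1; exact: rmorph1.
  by rewrite -raddf_sum -/(marginal P (i, l) j) mP entryE.
have [Q jQ wQ] := worst_case_exists (ex_intro _ _ jP).
exists (expected_profit mu Q) => //.
rewrite ler_distlC out; apply/andP; split.
  have est := estimate_le eps laws nonneg (erefl N) (erefl T) jQ.
  by apply: le_trans est; rewrite gerBl ler0q ltW.
apply: (@le_trans _ _ (expected_profit mu (fun w => ratr (P w)))).
  exact: wQ.2.
rewrite -raddfD /expected_profit; under eq_bigr do rewrite -rmorphM.
by rewrite -raddf_sum ler_rat.
Qed.
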